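(* Let $r_1,r_2>0$ with $r_1^2+r_2^2=1$ and let $n_1+n_2=n-1$. Let $\varphi_1:M_1^{m_1}\to\mathbb S^{n_1}(r_1)$ and $\varphi_2:M_2^{m_2}\to\mathbb S^{n_2}(r_2)$ be two non-minimal immersions such that $M^m=M_1^{m_1}\times M_2^{m_2}$, $m=m_1+m_2$, is proper biharmonic in $\mathbb S^n$ via $\iota\circ\varphi$, where $\varphi=\varphi_1\times\varphi_2$. Then $|H^{\iota\circ\varphi}|=1$ if and only if $\varphi_1$ and $\varphi_2$ are $PMC$ and pseudo-umbilical. Moreover, in this case there is a codimension reduction: $M$ is minimal in a small hypersphere $\mathbb S^{n-2}(1/\sqrt2)$ of a totally geodesic hypersphere $\mathbb S^{n-1}\subset\mathbb S^n$.
   Context: Manifolds are smooth and connected; immersions are isometric. $\mathbb S^n(r)$ is the Euclidean sphere of radius $r$ centered at the origin of $\mathbb R^{n+1}$, $\mathbb S^n=\mathbb S^n(1)$. For an isometric immersion $\varphi:M^m\to N$, $B$ is the second fundamental form, $A_\eta$ the shape operator in the normal direction $\eta$, $\nabla^\perp$ the normal connection, $H=\frac1m\operatorname{trace}B$ (written $H^\varphi$ to indicate the immersion). The immersion is minimal if $H=0$, $PMC$ if $\nabla^\perp H=0$, pseudo-umbilical if $A_H=|H|^2\operatorname{Id}$. The tension field is $\tau(\varphi)=mH$, and the bitension field is $\tau_2(\varphi)=-\Delta^\varphi\tau(\varphi)-\operatorname{trace}R^N(d\varphi(\cdot),\tau(\varphi))d\varphi(\cdot)$, where $\Delta^\varphi=-\operatorname{trace}(\nabla^\varphi\nabla^\varphi-\nabla^\varphi_{\nabla})$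 and $R^N(X,Y)Z=\nabla_X\nabla_YZ-\nabla_Y\nabla_XZ-\nabla_{[X,Y]}Z$. Biharmonic means $\tau_2(\varphi)=0$; proper biharmonic means biharmonic and not minimal. $\iota:\mathbb S^{n_1}(r_1)\times\mathbb S^{n_2}(r_2)\to\mathbb S^n$ is the canonical inclusion, and $M_1\times M_2$ carries the product metric. *)

(* Defs.v *)
From HB Require Import structures.
From mathcomp Require Import all_boot all_order all_algebra.
From mathcomp Require Import all_classical all_reals all_analysis.

Set Implicit Arguments.
Unset Strict Implicit.
Unset Printing Implicit Defensive.
Import Order.TTheory GRing.Theory Num.Theory.
Import numFieldNormedType.Exports.

Local Open Scope classical_set_scope.
Local Open Scope ring_scope.

Section Smooth.
Variable R : realType.

(* Meaningful when U is open. *)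
Fixpoint Ck (V W : normedModType R) (k : nat) (U : set V) (F : V -> W) : Prop :=
  if k is k'.+1 then
    (forall x, U x -> differentiable F x) /\
    (forall v, Ck k' U (fun x => 'D_v F x))
  else forall x, U x -> {for x, continuous F}.

Definition smooth_on (V W : normedModType R) (U : set V) (F : V -> W) : Prop :=
  forall k, Ck k U F.

Lemma near_differentiable (V W : normedModType R) (f g : V -> W) (x : V) :
  (\forall y \near x, f y = g y) -> differentiable f x -> differentiable g x.
Proof.
move=> fg df.
have fgx : f x = g x by exact: nbhs_singleton fg.
have dg : g \o shift x = cst (g x) + 'd f x +o_ 0 id.
  apply/eqaddoP => e e0.
  have /eqaddoP/(_ e e0) := diff_locally df.
  move=> H.
  have fg0 : \forall h \near (0 : V), f (h + x) = g (h + x).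
    move: fg; rewrite (near_shift 0) /= => fg0.
    by apply: filterS fg0 => h /=; rewrite subr0.
  near=> h.
  have -> : (g \o shift x - (cst (g x) + 'd f x)) h =
            (f \o shift x - (cst (f x) + 'd f x)) h.
    rewrite !fctE /= fgx; congr (_ - _).
    by apply/esym; near: h.
  by near: h.
have dgf := diff_unique (diff_continuous df) dg.
by apply/diff_locallyP; rewrite dgf; split => //; exact: diff_continuous.
Unshelve. all: by end_near. Qed.

Lemma Ck_ext (V W : normedModType R) k (U : set V) (F G : V -> W) :
  open U -> (forall x, U x -> F x = G x) -> Ck k U F -> Ck k U G.
Proof.
move=> oU; elim: k F G => [|k IH] F G FG /=.
  move=> cF x Ux.
  have nFG : \forall y \near x, F y = G y.
    by apply: filterS (open_nbhs_nbhs (conj oU Ux)) => y; exact: FG.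
  have /= := cF x Ux; rewrite /prop_for/continuous_at -(FG _ Ux) => h.
  by apply: cvg_trans h; exact: near_eq_cvg.
move=> [dF CF]; split => [x Ux|v].
  apply: near_differentiable (dF _ Ux).
  by apply: filterS (open_nbhs_nbhs (conj oU Ux)) => y; exact: FG.
move: (CF v); apply: IH => x Ux; apply: near_eq_derive => //.
by apply: filterS (open_nbhs_nbhs (conj oU Ux)) => y; exact: FG.
Qed.

Lemma Ck_sub (V W : normedModType R) k (U U' : set V) (F : V -> W) :
  U' `<=` U -> Ck k U F -> Ck k U' F.
Proof.
move=> sU; elim: k F => [|k IH] F /=; first by move=> h x /sU; exact: h.
by move=> [dF CF]; split => [x /sU|v]; [exact: dF|exact: IH].
Qed.

Lemma CkD (V W : normedModType R) k (U : set V) (F G : V -> W) :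
  open U -> Ck k U F -> Ck k U G -> Ck k U (fun x => F x + G x).
Proof.
move=> oU; elim: k F G => [|k IH] F G /=.
  by move=> cF cG x Ux; apply: continuousD; [exact: cF|exact: cG].
move=> [dF CF] [dG CG]; split => [x Ux|v].
  by apply: differentiableD; [exact: dF|exact: dG].
apply: (Ck_ext oU _ (IH _ _ (CF v) (CG v))) => x Ux.
by rewrite -deriveD //; apply: diff_derivable; [exact: dF|exact: dG].
Qed.

Lemma continuous_bigsum (V W : normedModType R) (I : Type) (r : seq I)
    (F : I -> V -> W) (x : V) :
  (forall i, {for x, continuous (F i)}) ->
  {for x, continuous (fun y => \sum_(i <- r) F i y)}.
Proof.
move=> cF; elim: r => [|i r IH].
  have -> : (fun y => \sum_(i <- [::]) F i y) = cst 0.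
    by apply/funext => y; rewrite big_nil.
  exact: cst_continuous.
have -> : (fun y => \sum_(j <- i :: r) F j y) =
    F i \+ (fun y => \sum_(j <- r) F j y).
  by apply/funext => y; rewrite big_cons.
by apply: continuousD; [exact: cF|exact: IH].
Qed.

Lemma mx_linear_continuous (W : normedModType R) p q
  (L : {linear 'M[R]_(p, q) -> W}) : continuous L.
Proof.
have -> : (L : _ -> _) =
    (fun M => \sum_i \sum_j M i j *: L (delta_mx i j)).
  apply/funext => M; rewrite {1}[M]matrix_sum_delta linear_sum /=.
  apply: eq_bigr => i _; rewrite linear_sum; apply: eq_bigr => j _.
  by rewrite linearZ.
move=> M.
apply: continuous_bigsum => i; apply: continuous_bigsum => j.
apply: (@cvgZr_tmp _ _ _ (nbhs M) _ (fun N : 'M[R]_(p, q) => N i j)).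
exact: (@coord_continuous _ _ _ i j M).
Qed.

Lemma mx_linear_differentiable (W : normedModType R) p q
  (L : {linear 'M[R]_(p, q) -> W}) x : differentiable L x.
Proof. exact/linear_differentiable/mx_linear_continuous. Qed.

Lemma derive_linl (V : normedModType R) p q p' q'
    (L : {linear 'M[R]_(p, q) -> 'M[R]_(p', q')}) (F : V -> 'M[R]_(p, q)) v x :
  differentiable F x -> 'D_v (fun y => L (F y)) x = L ('D_v F x).
Proof.
move=> D1; have dL := mx_linear_differentiable L.
have D2 : differentiable (fun y => L (F y)) x.
  by apply: differentiable_comp; [exact: D1|exact: dL].
rewrite (deriveE _ D1) (deriveE _ D2).
have -> : 'd (fun y => L (F y)) x v = 'd L (F x) ('d F x v).
  have := @diff_comp _ _ _ _ F L x D1 (dL (F x)).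
  by move=> /(congr1 (fun f => f v)).
have := diff_lin (F x) (@mx_linear_continuous _ _ _ L).
by move=> /(congr1 (fun f => f ('d F x v))) ->.
Qed.

Lemma Ck_linl (V : normedModType R) k (U : set V) p q p' q'
  (L : {linear 'M[R]_(p, q) -> 'M[R]_(p', q')}) (F : V -> 'M[R]_(p, q)) :
  open U -> Ck k U F -> Ck k U (fun x => L (F x)).
Proof.
move=> oU; elim: k F => [|k IH] F /=.
  move=> cF x Ux; apply: continuous_comp; first exact: cF.
  exact: mx_linear_continuous.
move=> [dF CF]; split => [x Ux|v].
  apply: differentiable_comp; first exact: dF.
  exact: mx_linear_differentiable.
apply: (Ck_ext oU _ (IH _ (CF v))) => x Ux.
by rewrite derive_linl //; exact: dF.
Qed.

Lemma derive_linr (W : normedModType R) p q p' q'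
  (L : {linear 'M[R]_(p, q) -> 'M[R]_(p', q')}) (F : 'M[R]_(p', q') -> W) v x :
  'D_v (fun x => F (L x)) x = 'D_(L v) F (L x).
Proof.
rewrite /derive; have Lv (h : R) : L (h *: v + x) = h *: L v + L x by exact: linearP.
by under [in LHS]eq_fun do rewrite /= Lv.
Qed.

Lemma Ck_linr (W : normedModType R) k p q p' q'
  (L : {linear 'M[R]_(p, q) -> 'M[R]_(p', q')}) (U : set 'M[R]_(p', q'))
  (F : 'M[R]_(p', q') -> W) :
  Ck k U F -> Ck k (L @^-1` U) (fun x => F (L x)).
Proof.
elim: k F => [|k IH] F /=.
  move=> cF x Ux; apply: continuous_comp; last exact: cF.
  exact: mx_linear_continuous.
move=> [dF CF]; split => [x Ux|v].
  apply: differentiable_comp; last exact: dF.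
  exact: mx_linear_differentiable.
have -> : (fun x => 'D_v (fun x0 => F (L x0)) x) = (fun x => 'D_(L v) F (L x)).
  by apply/funext => x; exact: derive_linr.
exact: (IH (fun y => 'D_(L v) F y) (CF (L v))).
Qed.

End Smooth.

Section Product_lemmas.
Variable R : realType.

Let injl {m1 m2} : {linear 'rV[R]_m1 -> 'rV[R]_(m1 + m2)} :=
  mulmxr (row_mx 1%:M 0).
Let injr {m1 m2} : {linear 'rV[R]_m2 -> 'rV[R]_(m1 + m2)} :=
  mulmxr (row_mx 0 1%:M).

Let row_mxE m1 m2 (u : 'rV[R]_m1) (v : 'rV[R]_m2) :
  row_mx u v = injl u + injr v.
Proof.
by rewrite /injl /injr /= !mul_mx_row !mulmx1 !mulmx0 add_row_mx addr0 add0r.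
Qed.

Let lsub {m1 m2} : {linear 'rV[R]_(m1 + m2) -> 'rV[R]_m1} := lsubmx.
Let rsub {m1 m2} : {linear 'rV[R]_(m1 + m2) -> 'rV[R]_m2} := rsubmx.

Lemma smooth_row_mx m1 m2 d1 d2 (U1 : set 'rV[R]_m1) (U2 : set 'rV[R]_m2)
    (F1 : 'rV[R]_m1 -> 'rV[R]_d1) (F2 : 'rV[R]_m2 -> 'rV[R]_d2) :
  open [set x : 'rV[R]_(m1 + m2) | U1 (lsubmx x) /\ U2 (rsubmx x)] ->
  smooth_on U1 F1 -> smooth_on U2 F2 ->
  smooth_on [set x : 'rV[R]_(m1 + m2) | U1 (lsubmx x) /\ U2 (rsubmx x)]
    (fun x => row_mx (F1 (lsubmx x)) (F2 (rsubmx x))).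
Proof.
move=> oU s1 s2 k.
have -> : (fun x : 'rV[R]_(m1 + m2) => row_mx (F1 (lsubmx x)) (F2 (rsubmx x)))
    = (fun x => injl (F1 (lsubmx x)) + injr (F2 (rsubmx x))).
  by apply/funext => x; rewrite row_mxE.
apply: CkD => //; apply: Ck_linl => //.
- by apply: Ck_sub (@Ck_linr _ _ k _ _ _ _ lsub _ _ (s1 k)) => x [].
- by apply: Ck_sub (@Ck_linr _ _ k _ _ _ _ rsub _ _ (s2 k)) => x [].
Qed.

Lemma smooth_block_diag m1 m2 (U1 : set 'rV[R]_m1) (U2 : set 'rV[R]_m2)
    (F1 : 'rV[R]_m1 -> 'M[R]_m1) (F2 : 'rV[R]_m2 -> 'M[R]_m2) :
  open [set x : 'rV[R]_(m1 + m2) | U1 (lsubmx x) /\ U2 (rsubmx x)] ->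
  smooth_on U1 F1 -> smooth_on U2 F2 ->
  smooth_on [set x : 'rV[R]_(m1 + m2) | U1 (lsubmx x) /\ U2 (rsubmx x)]
    (fun x => block_mx (F1 (lsubmx x)) 0 0 (F2 (rsubmx x))).
Proof.
move=> oU s1 s2 k.
pose L1 : {linear 'M[R]_m1 -> 'M[R]_(m1 + m2)} :=
  mulmxr (row_mx 1%:M 0) \o mulmx (col_mx 1%:M 0).
pose L2 : {linear 'M[R]_m2 -> 'M[R]_(m1 + m2)} :=
  mulmxr (row_mx 0 1%:M) \o mulmx (col_mx 0 1%:M).
have E A B : block_mx A 0 0 B = L1 A + L2 B.
  rewrite /L1 /L2 /= /mulmxr !mul_col_mx !mul1mx !mul0mx.
  by rewrite !mul_mx_row !mulmx0 !mulmx1 block_mxEv add_col_mx addr0 add0r.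
have -> : (fun x : 'rV[R]_(m1 + m2) =>
      block_mx (F1 (lsubmx x)) 0 0 (F2 (rsubmx x))) =
    (fun x => L1 (F1 (lsubmx x)) + L2 (F2 (rsubmx x))).
  by apply/funext => x; rewrite E.
apply: CkD => //; apply: Ck_linl => //.
- by apply: Ck_sub (@Ck_linr _ _ k _ _ _ _ lsub _ _ (s1 k)) => x [].
- by apply: Ck_sub (@Ck_linr _ _ k _ _ _ _ rsub _ _ (s2 k)) => x [].
Qed.

Lemma jacobian_row_mx m1 m2 d1 d2
    (F1 : 'rV[R]_m1 -> 'rV[R]_d1) (F2 : 'rV[R]_m2 -> 'rV[R]_d2)
    (x : 'rV[R]_(m1 + m2)) :
  differentiable F1 (lsubmx x) -> differentiable F2 (rsubmx x) ->
  'J (fun y : 'rV[R]_(m1 + m2) => row_mx (F1 (lsubmx y)) (F2 (rsubmx y))) x =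
  block_mx ('J F1 (lsubmx x)) 0 0 ('J F2 (rsubmx x)).
Proof.
move=> d1F d2F.
have dl : differentiable (fun y => F1 (lsub y)) x.
  apply: differentiable_comp; last exact: d1F.
  exact: mx_linear_differentiable.
have dr : differentiable (fun y => F2 (rsub y)) x.
  apply: differentiable_comp; last exact: d2F.
  exact: mx_linear_differentiable.
have dil : differentiable (fun y => @injl d1 d2 (F1 (lsub y))) x.
  apply: differentiable_comp; first exact: dl.
  exact: mx_linear_differentiable.
have dir : differentiable (fun y => @injr d1 d2 (F2 (rsub y))) x.
  apply: differentiable_comp; first exact: dr.
  exact: mx_linear_differentiable.
have E : (fun y : 'rV[R]_(m1 + m2) => row_mx (F1 (lsubmx y)) (F2 (rsubmx y))) =
    (fun y => injl (F1 (lsub y)) + injr (F2 (rsub y))).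
  by apply/funext => y; rewrite row_mxE.
have dE : differentiable (fun y : 'rV[R]_(m1 + m2) =>
    row_mx (F1 (lsubmx y)) (F2 (rsubmx y))) x.
  by rewrite E; exact: differentiableD.
apply/row_matrixP => i; rewrite !rowE; set v := delta_mx 0 i.
rewrite -deriveEjacobian // E deriveD; try exact: diff_derivable.
rewrite (derive_linl _ _ dl) (derive_linl _ _ dr) !derive_linr -row_mxE.
rewrite (deriveEjacobian _ d1F) (deriveEjacobian _ d2F).
rewrite -[v in RHS]hsubmxK mul_row_block !mulmx0 addr0 add0r.
by [].
Qed.

End Product_lemmas.

Section Manifold.
Variable R : realType.

(* [param a] is the inverse of the chart [chart_map a : dom a -> R^m]; both are
   total functions, with unspecified values off [dom a] and off its image. *)
Record manifold (m : nat) := Manifold {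
  points :> topologicalType ;
  chart : Type ;
  dom : chart -> set points ;
  chart_map : chart -> points -> 'rV[R]_m ;
  param : chart -> 'rV[R]_m -> points ;
  dom_open : forall a, open (dom a) ;
  img_open : forall a, open (chart_map a @` dom a) ;
  chart_mapK : forall a p, dom a p -> param a (chart_map a p) = p ;
  chart_map_continuous : forall a p, dom a p -> {for p, continuous (chart_map a)} ;
  param_continuous :
    forall a p, dom a p -> {for chart_map a p, continuous (param a)} ;
  dom_cover : forall p, exists a, dom a p ;
  transition_smooth : forall a b,
    smooth_on (chart_map a @` (dom a `&` dom b)) (chart_map b \o param a) ;
  points_hausdorff : hausdorff_space points ;
  points_second_countable : @second_countable points ;
  points_connected : connected [set: points]
}.

Definition img m (M : manifold m) (a : chart M) : set 'rV[R]_m :=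
  chart_map a @` dom a.

Definition transition m (M : manifold m) (a b : chart M) :
  'rV[R]_m -> 'rV[R]_m := chart_map b \o param a.

(* [metric a] is the Gram matrix of the metric in the coordinate frame of
   [a].  Tangent vectors are row vectors, so the Jacobian 'J of a map acts on
   the right and its i-th row is the i-th partial derivative. *)
Record riemannian (m : nat) := Riemannian {
  underlying :> manifold m ;
  metric : chart underlying -> 'rV[R]_m -> 'M[R]_m ;
  metric_smooth : forall a, smooth_on (img a) (metric a) ;
  metric_sym : forall a x, img a x -> (metric a x)^T = metric a x ;
  metric_pos : forall a x (v : 'rV[R]_m), img a x -> v != 0 ->
    0 < (v *m metric a x *m v^T) 0 0 ;
  metric_change : forall a b x, (chart_map a @` (dom a `&` dom b)) x ->
    metric a x = 'J (transition a b) x *m metric b (transition a b x)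
                   *m ('J (transition a b) x)^T
}.

End Manifold.

Section ProductTopology.

Lemma hausdorff_prod (T U : topologicalType) :
  hausdorff_space T -> hausdorff_space U -> hausdorff_space (T * U)%type.
Proof.
move=> hT hU [p1 p2] [q1 q2] cl; congr pair.
- apply: hT => A B nA nB.
  have [] := cl (A `*` setT) (B `*` setT).
  + by exists (A, setT) => //; split => //=; exact: filterT.
  + by exists (B, setT) => //; split => //=; exact: filterT.
  + by move=> [u v] [[/= Au _] [/= Bu _]]; exists u.
- apply: hU => A B nA nB.
  have [] := cl (setT `*` A) (setT `*` B).
  + by exists (setT, A) => //; split => //=; exact: filterT.
  + by exists (setT, B) => //; split => //=; exact: filterT.
  + by move=> [u v] [[/= _ Au] [/= _ Bu]]; exists v.
Qed.

Lemma open_prod (T U : topologicalType) (A : set T) (B : set U) :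
  open A -> open B -> open (A `*` B).
Proof.
move=> oA oB; rewrite openE => -[x y] [/= Ax By].
by exists (A, B) => //; split; exact: open_nbhs_nbhs.
Qed.

Lemma second_countable_prod (T U : topologicalType) :
  @second_countable T -> @second_countable U ->
  @second_countable (T * U)%type.
Proof.
move=> [B1 cB1 [oB1 bB1]] [B2 cB2 [oB2 bB2]].
exists ((fun AB => AB.1 `*` AB.2) @` (B1 `*` B2)).
  by apply: (sub_countable (card_image_le _ _)); exact: countableX.
split; first by move=> _ [[A B] [/= /oB1 oA /oB2 oB] <-]; exact: open_prod.
move=> [x y] S [[P Q] [/= nP nQ] PQS].
have [A [B1A Ax] AP] := bB1 _ _ nP.
have [B [B2B By] BQ] := bB2 _ _ nQ.
exists (A `*` B); first by split => //; exists (A, B).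
by move=> [u v] [/= /AP Pu /BQ Qv]; apply: PQS.
Qed.

Lemma connected_prod (T U : topologicalType) :
  connected [set: T] -> connected [set: U] -> connected [set: T * U].
Proof.
move=> cT cU.
have [[[x0 y0] _]|] := pselect ([set: T * U] !=set0); last first.
  by move=> /set0P/negP/negPn/eqP ->; exact: connected0.
have cX y : connected [set z : T * U | z.2 = y].
  have -> : [set z : T * U | z.2 = y] = (fun x => (x, y)) @` setT.
    by apply/seteqP; split => [[u v] /= <-|_ [u _ <-]] //; exists u.
  apply: connected_continuous_connected cT _; apply: continuous_subspaceT.
  by move=> x; apply: cvg_pair => //; exact: cvg_cst.
have cY x : connected [set z : T * U | z.1 = x].
  have -> : [set z : T * U | z.1 = x] = (fun y => (x, y)) @` setT.
    by apply/seteqP; split => [[u v] /= <-|_ [u _ <-]] //; exists v.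
  apply: connected_continuous_connected cU _; apply: continuous_subspaceT.
  by move=> y; apply: cvg_pair => //; exact: cvg_cst.
have -> : [set: T * U] = \bigcup_(y in setT)
    ([set z : T * U | z.1 = x0] `|` [set z | z.2 = y]).
  by apply/seteqP; split => // -[u v] _; exists v => //; right.
apply: bigcup_connected; first by exists (x0, y0) => y _; left.
by move=> y _; apply: connectedU => //; exists (x0, y).
Qed.

End ProductTopology.

Section ProductManifold.
Variables (R : realType) (m1 m2 : nat).

Section manifold.
Variables (M1 : manifold R m1) (M2 : manifold R m2).

Definition prod_points : topologicalType := (M1 * M2)%type.

Definition prod_chart : Type := (chart M1 * chart M2)%type.

Definition prod_dom (c : prod_chart) : set prod_points :=
  dom c.1 `*` dom c.2.

Definition prod_chart_map (c : prod_chart) (p : prod_points) : 'rV[R]_(m1 + m2) :=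
  row_mx (chart_map c.1 p.1) (chart_map c.2 p.2).

Definition prod_param (c : prod_chart) (x : 'rV[R]_(m1 + m2)) : prod_points :=
  (param c.1 (lsubmx x), param c.2 (rsubmx x)).

Lemma image_chart_open m (M : manifold R m) (a : chart M) (U : set M) :
  open U -> U `<=` dom a -> open (chart_map a @` U).
Proof.
move=> oU Ua; rewrite openE => _ [p Up <-].
have n1 : nbhs (chart_map a p) (param a @^-1` U).
  apply: (param_continuous (Ua _ Up)).
  by rewrite (chart_mapK (Ua _ Up)); exact: open_nbhs_nbhs.
have n2 : nbhs (chart_map a p) (chart_map a @` dom a).
  by apply: open_nbhs_nbhs; split; [exact: img_open|exists p => //; exact: Ua].
apply: (filterS2 _ _ n1 n2) => x /= Ux [q dq qx].
by exists (param a x) => //; rewrite -qx chart_mapK.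
Qed.

Lemma prod_image (c : prod_chart) (U1 : set M1) (U2 : set M2) :
  prod_chart_map c @` (U1 `*` U2) =
  [set x | (chart_map c.1 @` U1) (lsubmx x) /\ (chart_map c.2 @` U2) (rsubmx x)].
Proof.
apply/seteqP; split => [_ [[p q] [/= Up Uq] <-]|x [/= [p Up px] [q Uq qx]]].
  by rewrite /prod_chart_map row_mxKl row_mxKr; split; [exists p|exists q].
by exists (p, q) => //=; rewrite /prod_chart_map /= px qx hsubmxK.
Qed.

Lemma open_split (U1 : set 'rV[R]_m1) (U2 : set 'rV[R]_m2) :
  open U1 -> open U2 ->
  open [set x : 'rV[R]_(m1 + m2) | U1 (lsubmx x) /\ U2 (rsubmx x)].
Proof.
move=> o1 o2.
have -> : [set x : 'rV[R]_(m1 + m2) | U1 (lsubmx x) /\ U2 (rsubmx x)] =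
    (lsubmx @^-1` U1) `&` (rsubmx @^-1` U2) by [].
apply: openI; apply: open_comp => // x _.
- exact: continuous_lsubmx.
- exact: continuous_rsubmx.
Qed.

Lemma prod_image_open (c : prod_chart) (U1 : set M1) (U2 : set M2) :
  open U1 -> open U2 -> U1 `<=` dom c.1 -> U2 `<=` dom c.2 ->
  open (prod_chart_map c @` (U1 `*` U2)).
Proof.
by move=> o1 o2 s1 s2; rewrite prod_image; apply: open_split;
  exact: image_chart_open.
Qed.

Lemma prod_dom_open c : open (prod_dom c).
Proof. by apply: open_prod; exact: dom_open. Qed.

Lemma prod_img_open c : open (prod_chart_map c @` prod_dom c).
Proof. by apply: prod_image_open => //; exact: dom_open. Qed.

Lemma prod_chart_mapK c p : prod_dom c p -> prod_param c (prod_chart_map c p) = p.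
Proof.
case: p => p q [/= dp dq].
by rewrite /prod_param /prod_chart_map row_mxKl row_mxKr !chart_mapK.
Qed.

Lemma prod_chart_map_continuous c p :
  prod_dom c p -> {for p, continuous (prod_chart_map c)}.
Proof.
case: c p => a b [p q] [/= dp dq].
have -> : prod_chart_map (a, b) =
    (fun z : prod_points => mulmxr (row_mx 1%:M 0) (chart_map a z.1)
               + mulmxr (row_mx 0 1%:M) (chart_map b z.2)).
  apply/funext => z /=; rewrite /mulmxr !mul_mx_row !mulmx1 !mulmx0.
  by rewrite add_row_mx addr0 add0r.
apply: continuousD; apply: continuous_comp; try exact: mx_linear_continuous.
- apply: (@continuous_comp _ _ _ fst (chart_map a)); first exact: cvg_fst.
  exact: chart_map_continuous.
- apply: (@continuous_comp _ _ _ snd (chart_map b)); first exact: cvg_snd.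
  exact: chart_map_continuous.
Qed.

Lemma prod_param_continuous c p :
  prod_dom c p -> {for prod_chart_map c p, continuous (prod_param c)}.
Proof.
case: c p => a b [p q] [/= dp dq].
set x := prod_chart_map _ _.
have c1 : {for x, continuous (param a \o lsubmx)}.
  apply: continuous_comp; first exact: continuous_lsubmx.
  by rewrite /= /x /prod_chart_map row_mxKl; exact: param_continuous.
have c2 : {for x, continuous (param b \o rsubmx)}.
  apply: continuous_comp; first exact: continuous_rsubmx.
  by rewrite /= /x /prod_chart_map row_mxKr; exact: param_continuous.
exact: (cvg_pair c1 c2).
Qed.

Lemma prod_dom_cover p : exists c, prod_dom c p.
Proof.
by case: p => p q; have [a da] := dom_cover p; have [b db] := dom_cover q;
  exists (a, b).
Qed.

Lemma prod_domI c c' : prod_dom c `&` prod_dom c' =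
  (dom c.1 `&` dom c'.1) `*` (dom c.2 `&` dom c'.2).
Proof.
by apply/seteqP; split => [[p q] [[/= ? ?] [/= ? ?]]|[p q] [[/= ? ?] [/= ? ?]]].
Qed.

Lemma prod_transition_smooth c c' :
  smooth_on (prod_chart_map c @` (prod_dom c `&` prod_dom c'))
            (prod_chart_map c' \o prod_param c).
Proof.
have o : open (prod_chart_map c @` (prod_dom c `&` prod_dom c')).
  rewrite prod_domI; apply: prod_image_open;
    by [apply: openI; exact: dom_open|move=> ? []].
move: o; rewrite prod_domI prod_image => o.
exact: (smooth_row_mx o (transition_smooth c.1 c'.1)
                        (transition_smooth c.2 c'.2)).
Qed.

Definition prod_manifold : manifold R (m1 + m2) := {|
  points := prod_points ;
  dom := prod_dom ;
  chart_map := prod_chart_map ;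
  param := prod_param ;
  dom_open := prod_dom_open ;
  img_open := prod_img_open ;
  chart_mapK := prod_chart_mapK ;
  chart_map_continuous := prod_chart_map_continuous ;
  param_continuous := prod_param_continuous ;
  dom_cover := prod_dom_cover ;
  transition_smooth := prod_transition_smooth ;
  points_hausdorff :=
    hausdorff_prod (@points_hausdorff _ _ M1) (@points_hausdorff _ _ M2) ;
  points_second_countable :=
    second_countable_prod (@points_second_countable _ _ M1)
                          (@points_second_countable _ _ M2) ;
  points_connected :=
    connected_prod (@points_connected _ _ M1) (@points_connected _ _ M2)
|}.

End manifold.

Variables (M1 : riemannian R m1) (M2 : riemannian R m2).

Definition prod_metric (c : chart (prod_manifold M1 M2)) (x : 'rV[R]_(m1 + m2)) :
    'M[R]_(m1 + m2) :=
  block_mx (metric c.1 (lsubmx x)) 0 0 (metric c.2 (rsubmx x)).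

Lemma prod_img (c : chart (prod_manifold M1 M2)) :
  img c = [set x | img c.1 (lsubmx x) /\ img c.2 (rsubmx x)].
Proof. exact: prod_image. Qed.

Lemma prod_metric_smooth c : smooth_on (img c) (prod_metric c).
Proof.
have o : open (img c) by exact: prod_img_open.
move: o; rewrite prod_img => o.
exact: (smooth_block_diag o (@metric_smooth _ _ M1 c.1)
                            (@metric_smooth _ _ M2 c.2)).
Qed.

Lemma prod_metric_sym c x :
  img c x -> (prod_metric c x)^T = prod_metric c x.
Proof.
rewrite prod_img => -[i1 i2].
by rewrite /prod_metric tr_block_mx !trmx0 !metric_sym.
Qed.

Lemma metric_ge0 m (M : riemannian R m) (a : chart M) x (v : 'rV[R]_m) :
  img a x -> 0 <= (v *m metric a x *m v^T) 0 0.
Proof.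
move=> ix; have [->|v0] := eqVneq v 0; first by rewrite !mul0mx mxE.
exact/ltW/metric_pos.
Qed.

Lemma prod_metric_pos c x (v : 'rV[R]_(m1 + m2)) : img c x -> v != 0 ->
  0 < (v *m prod_metric c x *m v^T) 0 0.
Proof.
rewrite prod_img => -[i1 i2].
move: (lsubmx v) (rsubmx v) (hsubmxK v) => l r <- v0.
rewrite tr_row_mx mul_row_block !mulmx0 addr0 add0r mul_row_col mxE.
have [l0|l0] := eqVneq l 0.
  apply: ltr_wpDl; first exact: metric_ge0.
  apply: metric_pos => //; apply: contra_neq v0 => r0.
  by rewrite l0 r0 row_mx0.
by apply: ltr_pwDl; [exact: metric_pos|exact: metric_ge0].
Qed.

Lemma transition_differentiable m (M : manifold R m) (a b : chart M) x :
  (chart_map a @` (dom a `&` dom b)) x -> differentiable (transition a b) x.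
Proof. by move=> h; have [+ _] := transition_smooth a b 1; exact. Qed.

Lemma prod_metric_change c c' x :
  (prod_chart_map c @` (prod_dom c `&` prod_dom c')) x ->
  let t := @transition _ _ (prod_manifold M1 M2) c c' in
  prod_metric c x = 'J t x *m prod_metric c' (t x) *m ('J t x)^T.
Proof.
rewrite prod_domI prod_image => -[i1 i2] /=.
have Jt := jacobian_row_mx (transition_differentiable i1)
                           (transition_differentiable i2).
have -> : 'J (@transition _ _ (prod_manifold M1 M2) c c') x =
  block_mx ('J (transition c.1 c'.1) (lsubmx x)) 0 0
           ('J (transition c.2 c'.2) (rsubmx x)) by exact: Jt.
rewrite tr_block_mx !trmx0 /prod_metric /transition /= /prod_chart_map.
rewrite row_mxKl row_mxKr !mulmx_block !(mulmx0, mul0mx, addr0, add0r).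
by rewrite (metric_change i1) (metric_change i2).
Qed.

Definition prod_riemannian : riemannian R (m1 + m2) := {|
  underlying := prod_manifold M1 M2 ;
  metric := prod_metric ;
  metric_smooth := prod_metric_smooth ;
  metric_sym := prod_metric_sym ;
  metric_pos := prod_metric_pos ;
  metric_change := prod_metric_change
|}.

End ProductManifold.

Section Sphere.
Variables (R : realType) (d : nat).
Implicit Types (y u v w : 'rV[R]_d) (X Y Z : 'rV[R]_d -> 'rV[R]_d).

(* The library norm on 'rV[R]_d is the sup norm. *)
Definition dot u v : R := (u *m v^T) 0 0.

Definition enorm u : R := Num.sqrt (dot u u).

(* the round sphere of dimension d - 1 and radius r in R^d *)
Definition sphere (r : R) : set 'rV[R]_d := [set y | enorm y = r].

(* orthogonal projection onto the tangent space at y of the sphere centered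
   at 0 through y (y <> 0); this does not refer to the radius *)
Definition tan_proj y v : 'rV[R]_d := v - (dot v y / dot y y) *: y.

(* Levi-Civita connection of the centered spheres: the tangential part of the
   flat derivative.  Vector fields on a sphere are represented by fields on
   R^d minus 0 that are tangent to all centered spheres. *)
Definition sphere_nabla X Y : 'rV[R]_d -> 'rV[R]_d :=
  fun y => tan_proj y ('D_(X y) Y y).

Definition lie_bracket X Y : 'rV[R]_d -> 'rV[R]_d :=
  fun y => 'D_(X y) Y y - 'D_(Y y) X y.

Definition curvature_op X Y Z : 'rV[R]_d -> 'rV[R]_d :=
  fun y => sphere_nabla X (sphere_nabla Y Z) y
         - sphere_nabla Y (sphere_nabla X Z) y
         - sphere_nabla (lie_bracket X Y) Z y.

Definition tangent_extension u : 'rV[R]_d -> 'rV[R]_d := fun y => tan_proj y u.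

(* R(u, v)w at y for tangent vectors u, v, w at y; by tensoriality the choice
   of extensions is irrelevant *)
Definition sphere_curvature y u v w : 'rV[R]_d :=
  curvature_op (tangent_extension u) (tangent_extension v)
               (tangent_extension w) y.

End Sphere.

Section Immersions.
Variables (R : realType) (m d : nat) (M : riemannian R m) (f : M -> 'rV[R]_d).

(* The target is a centered sphere of R^d containing the image of f, equipped
   with its induced metric.  Tensors are given by their components in the
   coordinate frame of a chart a, as functions of the coordinates x. *)
Section LocalExpressions.
Variable a : chart M.
Implicit Types (i j k l : 'I_m) (x : 'rV[R]_m) (V eta : 'rV[R]_m -> 'rV[R]_d).

Definition local_map : 'rV[R]_m -> 'rV[R]_d := f \o param a.

Definition partial i V x : 'rV[R]_d := 'D_(delta_mx 0 i) V x.

Definition dmap i x : 'rV[R]_d := partial i local_map x.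

Definition inv_metric x : 'M[R]_m := invmx (metric a x).

Definition dmetric l x : 'M[R]_m := 'D_(delta_mx 0 l) (metric a) x.

Definition christoffel k i j x : R :=
  2^-1 * \sum_l inv_metric x k l *
         (dmetric i x j l + dmetric j x i l - dmetric l x i j).

(* the pull-back to M of the Levi-Civita connection of the sphere *)
Definition nabla_pullback i V x : 'rV[R]_d :=
  tan_proj (local_map x) (partial i V x).

(* B(X, Y) = nabla_X (df Y) - df (nabla_X Y) *)
Definition second_fundamental_form i j x : 'rV[R]_d :=
  nabla_pullback i (dmap j) x - \sum_k christoffel k i j x *: dmap k x.

Definition mean_curvature x : 'rV[R]_d :=
  m%:R^-1 *:
    \sum_i \sum_j inv_metric x i j *: second_fundamental_form i j x.

Definition normal_part x (v : 'rV[R]_d) : 'rV[R]_d :=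
  v - \sum_k \sum_l (inv_metric x k l * dot v (dmap k x)) *: dmap l x.

Definition nabla_normal i eta x : 'rV[R]_d :=
  normal_part x (nabla_pullback i eta x).

(* matrix, acting on row vectors, of the endomorphism A_eta such that
   <A_eta X, Y> = <B(X, Y), eta> *)
Definition shape_operator eta x : 'M[R]_m :=
  (\matrix_(i, j) dot (second_fundamental_form i j x) (eta x)) *m inv_metric x.

Definition tension x : 'rV[R]_d := m%:R *: mean_curvature x.

Definition rough_laplacian V x : 'rV[R]_d :=
  - \sum_i \sum_j inv_metric x i j *:
      (nabla_pullback i (nabla_pullback j V) x
       - \sum_k christoffel k i j x *: nabla_pullback k V x).

Definition bitension x : 'rV[R]_d :=
  - rough_laplacian tension x
  - \sum_i \sum_j inv_metric x i j *:
      sphere_curvature (local_map x) (dmap i x) (tension x) (dmap j x).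

End LocalExpressions.

Definition isometric_immersion (r : R) : Prop :=
  (forall p, sphere r (f p)) /\
  (forall a : chart M,
    smooth_on (img a) (local_map a) /\
    forall x, img a x ->
      row_free ('J (local_map a) x) /\
      forall i j, dot (dmap a i x) (dmap a j x) = metric a x i j).

Definition minimal : Prop :=
  forall (a : chart M) x, img a x -> mean_curvature a x = 0.

Definition pmc : Prop :=
  forall (a : chart M) x, img a x ->
  forall i, nabla_normal a i (mean_curvature a) x = 0.

Definition pseudo_umbilical : Prop :=
  forall (a : chart M) x, img a x ->
    shape_operator a (mean_curvature a) x =
    (enorm (mean_curvature a x) ^+ 2)%:M.

Definition biharmonic : Prop :=
  forall (a : chart M) x, img a x -> bitension a x = 0.

Definition proper_biharmonic : Prop := biharmonic /\ ~ minimal.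

Definition unit_mean_curvature : Prop :=
  forall (a : chart M) x, img a x -> enorm (mean_curvature a x) = 1.

End Immersions.

(* iota o (phi1 x phi2), with R^(d1 + d2) = R^d1 x R^d2 *)
Definition prod_immersion (R : realType) (m1 m2 d1 d2 : nat)
    (M1 : riemannian R m1) (M2 : riemannian R m2)
    (phi1 : M1 -> 'rV[R]_d1) (phi2 : M2 -> 'rV[R]_d2) :
    prod_riemannian M1 M2 -> 'rV[R]_(d1 + d2) :=
  fun p => row_mx (phi1 p.1) (phi2 p.2).

(* y |-> (y, sqrt (1 - rho^2)) embeds the sphere of radius rho of R^k as a
   small hypersphere of the unit sphere of R^(k + 1). *)
Definition small_hypersphere_incl (R : realType) (k : nat) (rho : R)
    (y : 'rV[R]_k) : 'rV[R]_(k + 1) :=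
  row_mx y (Num.sqrt (1 - rho ^+ 2))%:M.

(* Here d = k + 2.  A has orthonormal rows, so z |-> z *m A identifies the unit
   sphere of R^(k + 1) isometrically with a totally geodesic hypersphere of the
   unit sphere of R^d, and every such hypersphere arises in this way; rotating
   A moves small_hypersphere_incl to any small hypersphere of radius rho. *)
Definition minimal_in_small_hypersphere (R : realType) (m k d : nat)
    (rho : R) (M : riemannian R m) (f : M -> 'rV[R]_d) : Prop :=
  exists (A : 'M[R]_(k + 1, d)) (psi : M -> 'rV[R]_k),
    [/\ A *m A^T = 1%:M,
        isometric_immersion psi rho,
        minimal psi
      & forall p, f p = small_hypersphere_incl rho (psi p) *m A].

Arguments minimal_in_small_hypersphere {R m} k {d} rho M f.

(* Main.v *)
(** View everything in Euclidean space and let lap be the Laplacian of M acting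
    on vector-valued functions.  For an immersion f into the sphere of radius r
    one has tau = lap f + (m / r^2) f, and for r = 1 the bitension is
    lap tau - |tau|^2 f + m tau.  For a product (f1, f2), with m = m1 + m2 and
    c_i = m - m_i / r_i^2, the tension is (tau1 + c1 f1, tau2 + c2 f2), so f is
    biharmonic iff lap tau_i = (|tau|^2 - c_i^2) f_i - (m + c_i) tau_i.

    Pairing with f_i gives |tau_i|^2 = r_i^2 (|tau|^2 - c_i^2); separating the
    variables of the two factors, |tau_1|, |tau_2| and |tau| are constant.  Pairing
    with tau_i then gives |d tau_i|^2 = (m + c_i) |tau_i|^2, whereas Cauchy-Schwarz
    on the tangential part of d tau_i gives |d tau_i|^2 >= |tau_i|^4 / m_i, with
    equality iff d tau_i = - (|tau_i|^2 / m_i) df_i, that is, iff f_i is PMC and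
    pseudo-umbilical.  Equality amounts to |tau_i|^2 = m_i (m + c_i), i.e. to
    |tau| = m.

    In that case v_i = tau_i + (m + c_i) f_i is a constant vector, f_i lies in an
    affine hyperplane orthogonal to v_i, and lap f = 2 m (W - f) for
    W = (v1, v2) / (2 m), which says that f - W is minimal in a sphere of radius
    1 / sqrt 2. *)
Require Import Defs.
From HB Require Import structures.
From mathcomp Require Import all_boot all_order all_algebra.
From mathcomp Require Import all_classical all_reals all_analysis.
From mathcomp Require Import ring lra.

Set Implicit Arguments.
Unset Strict Implicit.
Unset Printing Implicit Defensive.
Import Order.TTheory GRing.Theory Num.Theory.
Import numFieldNormedType.Exports.

Local Open Scope classical_set_scope.
Local Open Scope ring_scope.

(** * Smooth maps between normed spaces *)

Section Calculus.
Variable R : realType.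

Lemma Ck_le (V W : normedModType R) j k (U : set V) (F : V -> W) :
  (j <= k)%N -> Ck k U F -> Ck j U F.
Proof.
elim: k j F => [|k IH] [|j] F //= jk [dF DF].
  by move=> x Ux; exact/differentiable_continuous/dF.
by split => // v; exact: IH (DF v).
Qed.

Section bilinear.
Variables (V U1 U2 W : normedModType R) (b : {bilinear U1 -> U2 -> W}).
Hypothesis bc : continuous (fun p => b p.1 p.2).

Lemma differentiable_bilinear (F : V -> U1) (G : V -> U2) x :
  differentiable F x -> differentiable G x ->
  differentiable (fun y => b (F y) (G y)) x.
Proof.
move=> dF dG.
apply: (@differentiable_comp _ _ _ _ (fun y => (F y, G y)) (fun p => b p.1 p.2)).
  exact: differentiable_pair.
exact: differentiable_bilin.
Qed.

Lemma derive_bilinear (F : V -> U1) (G : V -> U2) v x :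
  differentiable F x -> differentiable G x ->
  'D_v (fun y => b (F y) (G y)) x = b ('D_v F x) (G x) + b (F x) ('D_v G x).
Proof.
move=> dF dG; rewrite !deriveE //; last exact: differentiable_bilinear.
have dP : differentiable (fun y => (F y, G y)) x by exact: differentiable_pair.
have := @diff_comp _ _ _ _ (fun y => (F y, G y)) (fun p => b p.1 p.2) x dP
          (differentiable_bilin _ bc).
move=> /(congr1 (fun f => f v)) /= ->.
by rewrite diff_bilin //= diff_pair //= addrC.
Qed.

(** By the product rule a derivative is a sum of two products, each with one factor differentiated;
    the regularity of the other factor is lowered by one to apply the induction hypothesis. *)
Lemma Ck_bilinear k (U : set V) (F : V -> U1) (G : V -> U2) :
  open U -> Ck k U F -> Ck k U G -> Ck k U (fun y => b (F y) (G y)).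
Proof.
move=> oU; elim: k F G => [|k IH] F G CF CG.
  move=> x Ux; apply: (@continuous_comp _ _ _ (fun y => (F y, G y))
      (fun p => b p.1 p.2)); last exact: bc.
  by apply: cvg_pair; [exact: CF|exact: CG].
have [dF DF] := CF; have [dG DG] := CG.
split => [x Ux|v]; first by apply: differentiable_bilinear; [exact: dF|exact: dG].
apply: (Ck_ext oU _ (CkD oU (IH _ _ (DF v) (Ck_le (leqnSn k) CG))
    (IH _ _ (Ck_le (leqnSn k) CF) (DG v)))) => x Ux.
by rewrite derive_bilinear //; [exact: dF|exact: dG].
Qed.

End bilinear.

Lemma scale_is_bilinear (W : normedModType R) :
  bilinear_for
    (GRing.Scale.Law.clone _ _ *:%R _) (GRing.Scale.Law.clone _ _ *:%R _)
    (@GRing.scale R W).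
Proof.
split=> [u'|u] a x y /=; first by rewrite scalerDl scalerA.
by rewrite scalerDr !scalerA mulrC.
Qed.

HB.instance Definition _ (W : normedModType R) :=
  bilinear_isBilinear.Build R R W W _ _ (@GRing.scale R W)
    (@scale_is_bilinear W).

Lemma dot_is_bilinear d :
  bilinear_for
    (GRing.Scale.Law.clone _ _ *:%R _) (GRing.Scale.Law.clone _ _ *:%R _)
    (@dot R d).
Proof.
split=> [u'|u] a x y; rewrite /dot.
- by rewrite mulmxDl -scalemxAl !mxE.
- by rewrite linearP /= mulmxDr -scalemxAr !mxE.
Qed.

HB.instance Definition _ d :=
  bilinear_isBilinear.Build R _ _ _ _ _ (@dot R d) (@dot_is_bilinear d).

Lemma dotE d (u v : 'rV[R]_d) : dot u v = \sum_j u 0 j * v 0 j.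
Proof. by rewrite /dot mxE; apply: eq_bigr => j _; rewrite mxE. Qed.

Lemma dot_continuous d :
  continuous (fun p : 'rV[R]_d * 'rV[R]_d => dot p.1 p.2).
Proof.
have -> : (fun p : 'rV[R]_d * 'rV[R]_d => dot p.1 p.2) =
    (fun p => \sum_j p.1 0 j * p.2 0 j).
  by apply/funext => p; rewrite dotE.
move=> p; apply: continuous_bigsum => j.
apply: (@continuousM _ _ (fun p : 'rV[R]_d * 'rV[R]_d => p.1 0 j)
    (fun p : 'rV[R]_d * 'rV[R]_d => p.2 0 j)).
- apply: (@continuous_comp _ _ _ fst (fun N : 'rV[R]_d => N 0 j)).
    exact: cvg_fst.
  exact: coord_continuous.
- apply: (@continuous_comp _ _ _ snd (fun N : 'rV[R]_d => N 0 j)).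
    exact: cvg_snd.
  exact: coord_continuous.
Qed.

Lemma scale_bilinear_continuous (W : normedModType R) :
  continuous (fun p : R * W => p.1 *: p.2).
Proof. by move=> p; apply: scale_continuous. Qed.

Section rules.
Variable V : normedModType R.
Implicit Types (x v : V) (U : set V).

Lemma derive_scale (W : normedModType R) (c : V -> R) (F : V -> W) v x :
  differentiable c x -> differentiable F x ->
  'D_v (fun y => c y *: F y) x = 'D_v c x *: F x + c x *: 'D_v F x.
Proof.
exact: (derive_bilinear (b := @GRing.scale R W) (@scale_bilinear_continuous W)).
Qed.

Lemma derive_dot d (F G : V -> 'rV[R]_d) v x :
  differentiable F x -> differentiable G x ->
  'D_v (fun y => dot (F y) (G y)) x = dot ('D_v F x) (G x) + dot (F x) ('D_v G x).
Proof. exact: (derive_bilinear (b := @dot R d) (@dot_continuous d)). Qed.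

Lemma smooth_differentiable (W : normedModType R) U (F : V -> W) x :
  smooth_on U F -> U x -> differentiable F x.
Proof. by move=> /(_ 1%N) [+ _]; exact. Qed.

Lemma smooth_derive (W : normedModType R) U (F : V -> W) v :
  smooth_on U F -> smooth_on U ('D_v F).
Proof. by move=> sF k; have [_] := sF k.+1; exact. Qed.

Lemma smooth_ext (W : normedModType R) U (F G : V -> W) :
  open U -> (forall x, U x -> F x = G x) -> smooth_on U F -> smooth_on U G.
Proof. by move=> oU FG sF k; exact: Ck_ext (sF k). Qed.

Lemma smooth_cst (W : normedModType R) U (w : W) : smooth_on U (fun _ => w).
Proof.
move=> k; elim: k w => [|k IH] w /=; first by move=> x _; exact: cst_continuous.
split => [x _|v]; first exact: differentiable_cst.
by under eq_fun do rewrite (@derive_cst _ V W w); exact: IH.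
Qed.

Lemma smoothD (W : normedModType R) U (F G : V -> W) :
  open U -> smooth_on U F -> smooth_on U G -> smooth_on U (fun x => F x + G x).
Proof. by move=> oU sF sG k; exact: CkD. Qed.

Lemma smooth_scale (W : normedModType R) U (c : V -> R) (F : V -> W) :
  open U -> smooth_on U c -> smooth_on U F ->
  smooth_on U (fun x => c x *: F x).
Proof.
by move=> oU sc sF k; exact: (Ck_bilinear (b := @GRing.scale R W)
  (@scale_bilinear_continuous W)).
Qed.

Lemma smoothM U (F G : V -> R) :
  open U -> smooth_on U F -> smooth_on U G ->
  smooth_on U (fun x => F x * G x).
Proof. exact: (@smooth_scale R). Qed.

Lemma smoothN (W : normedModType R) U (F : V -> W) :
  open U -> smooth_on U F -> smooth_on U (fun x => - F x).
Proof.
move=> oU sF; apply: (smooth_ext oU (F := fun x => -1 *: F x)).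
  by move=> x _; rewrite scaleN1r.
by apply: smooth_scale => //; exact: smooth_cst.
Qed.

Lemma smoothB (W : normedModType R) U (F G : V -> W) :
  open U -> smooth_on U F -> smooth_on U G -> smooth_on U (fun x => F x - G x).
Proof. by move=> oU sF sG; apply: smoothD => //; exact: smoothN. Qed.

Lemma smooth_sum (W : normedModType R) (I : Type) (r : seq I) (P : pred I) U
    (F : I -> V -> W) :
  open U -> (forall i, smooth_on U (F i)) ->
  smooth_on U (fun x => \sum_(i <- r | P i) F i x).
Proof.
move=> oU sF; elim: r => [|i r IH].
  by under eq_fun do rewrite big_nil; exact: smooth_cst.
under eq_fun do rewrite big_cons; case: (P i) => //.
exact: smoothD.
Qed.

Lemma smooth_prod (I : Type) (r : seq I) (P : pred I) U (F : I -> V -> R) :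
  open U -> (forall i, smooth_on U (F i)) ->
  smooth_on U (fun x => \prod_(i <- r | P i) F i x).
Proof.
move=> oU sF; elim: r => [|i r IH].
  by under eq_fun do rewrite big_nil; exact: smooth_cst.
under eq_fun do rewrite big_cons; case: (P i) => //.
exact: smoothM.
Qed.

(** The derivative is -F^-2 DF, so the induction hypothesis for the inverse, used twice, and the
    smoothness of DF settle the next order. *)
Lemma smooth_inv U (F : V -> R) :
  open U -> smooth_on U F -> (forall x, U x -> F x != 0) ->
  smooth_on U (fun x => (F x)^-1).
Proof.
move=> oU sF F0 k; elim: k => [|k IH] /=.
  by move=> x Ux; apply: continuousV; [exact: F0|exact: (sF 0%N)].
split=> [x Ux|v].
  by apply: differentiableV; [exact: (smooth_differentiable sF)|exact: F0].
have mulC := Ck_bilinear (b := @GRing.scale R R)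
  (@scale_bilinear_continuous R) oU.
have sDF := smoothN oU (smooth_derive v sF).
apply: (Ck_ext oU _ (mulC _ _ _ (mulC _ _ _ IH IH) (sDF k))) => x Ux.
have := @deriveV _ _ F x v (F0 _ Ux); rewrite /= => ->.
  by rewrite /= /GRing.scale /= mulrN mulNr expr2 invfM.
exact/diff_derivable/(smooth_differentiable sF).
Qed.

End rules.
End Calculus.

(** * Mean values along lines and symmetry of second derivatives *)

Section MeanValue.
Variables (R : realType) (V : normedModType R).

Lemma is_derive_line (W : normedModType R) (f : V -> W) (x u : V) (t : R) :
  derivable f (t *: u + x) u ->
  is_derive t (1 : R) (fun s : R => f (s *: u + x)) ('D_u f (t *: u + x)).
Proof.
move=> df.
have E : (fun h : R => h^-1 *: (((fun s : R => f (s *: u + x)) \o shift t) (h *: 1)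
             - f (t *: u + x))) =
    (fun h : R => h^-1 *: ((f \o shift (t *: u + x)) (h *: u) - f (t *: u + x))).
  apply/funext => h /=; congr (_ *: (f _ - _)).
  by rewrite [h *: 1]mulr1 scalerDl addrA.
by apply: DeriveDef; rewrite /derivable /derive E.
Qed.

Lemma mean_value_line (f : V -> R) (x u : V) (h : R) : 0 < h ->
  (forall t, 0 <= t <= h -> differentiable f (t *: u + x)) ->
  exists2 c, 0 < c < h & f (h *: u + x) - f x = h * 'D_u f (c *: u + x).
Proof.
move=> h0 df.
have dl t : 0 <= t <= h ->
    is_derive t (1 : R) (fun s : R => f (s *: u + x)) ('D_u f (t *: u + x)).
  by move=> /df dt; apply: is_derive_line; exact: diff_derivable.
have [||c + E] := @MVT R (fun s : R => f (s *: u + x))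
    (fun t => 'D_u f (t *: u + x)) 0 h h0.
- by move=> t; rewrite in_itv /= => /andP[t0 th]; apply: dl; rewrite !ltW.
- apply: derivable_within_continuous => t; rewrite in_itv /= => th.
  exact/(@ex_derive _ _ _ _ _ _ _ (dl t th)).
rewrite in_itv /= => ch; exists c => //.
by move: E; rewrite scale0r add0r subr0 mulrC.
Qed.

(** Balls are convex, so the mean value theorem applies on the segment from [x] to [y]. *)
Lemma constant_of_derive0 (f : V -> R) (x : V) (e : R) :
  (forall y, ball x e y -> differentiable f y) ->
  (forall y v, ball x e y -> 'D_v f y = 0) ->
  forall y, ball x e y -> f y = f x.
Proof.
move=> df f0 y xy.
have bl t : 0 <= t <= 1 -> ball x e (t *: (y - x) + x).
  move=> /andP[t0 t1]; move: xy; rewrite -ball_normE /= => xy.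
  rewrite opprD addrCA subrr addr0 normrN normrZ ger0_norm //.
  by apply: le_lt_trans xy; rewrite distrC ler_piMl.
have [|c /andP[c0 c1] E] := @mean_value_line f x (y - x) 1 ltr01.
  by move=> t /bl; exact: df.
apply/eqP; rewrite -subr_eq0; move: E; rewrite scale1r subrK mul1r => ->.
by rewrite f0 //; apply: bl; rewrite !ltW.
Qed.

(* Both mixed derivatives are limits of the same second difference quotient. *)
Lemma derive_comm (f : V -> R) (U : set V) (u v x : V) :
  open U -> smooth_on U f -> U x -> 'D_u ('D_v f) x = 'D_v ('D_u f) x.
Proof.
move=> oU sf Ux.
have [e /= e0 eU] : exists2 e : R, 0 < e & ball x e `<=` U.
  by have /nbhs_ballP[e /= e0 eU] := open_nbhs_nbhs (conj oU Ux); exists e.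
(* With this [K], the parallelogram at [x] with sides (d / K) u and (d / K) v lies inside the ball
   of radius d. *)
pose K := `|u| + `|v| + 1.
have K0 : 0 < K by rewrite ltr_wpDl // addr_ge0.
have inb (d p q : R) : 0 < d -> 0 <= p <= d / K -> 0 <= q <= d / K ->
    ball x d (p *: u + (q *: v + x)).
  move=> d0 /andP[p0 pd] /andP[q0 qd]; rewrite -ball_normE /=.
  rewrite addrA opprD addrCA subrr addr0 normrN.
  apply: (le_lt_trans (ler_normD _ _)); rewrite !normrZ !ger0_norm //.
  apply: (@le_lt_trans _ _ (d / K * (`|u| + `|v|))).
    by rewrite mulrDr lerD // ler_wpM2r.
  by rewrite -mulrA gtr_pMr // mulrC ltr_pdivrMr // mul1r ltrDl.
have dif g : smooth_on U g -> forall y, ball x e y -> differentiable g y.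
  by move=> sg y /eU; exact: smooth_differentiable.
(* Two mean value steps: along [a] for the increment [G] of [g] in direction [b], then along [b] for
   the derivative of [g] along [a]. Both orders of [u] and [v] are covered. *)
have second a b g : a = u /\ b = v \/ a = v /\ b = u ->
    smooth_on U g -> forall d : R, 0 < d -> d <= e -> exists2 y, ball x d y &
    (g ((d / K) *: a + ((d / K) *: b + x)) - g ((d / K) *: a + x)) -
    (g ((d / K) *: b + x) - g x) = d / K * (d / K * 'D_b ('D_a g) y).
  move=> ab sg d d0 de; set h := d / K.
  have h0 : 0 < h by rewrite divr_gt0.
  have hh : 0 <= h <= h by rewrite lexx ltW.
  have inb' (p q : R) : 0 <= p <= h -> 0 <= q <= h -> ball x d (p *: a + (q *: b + x)).
    case: ab => [[-> ->]|[-> ->]] ph qh; first exact: inb.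
    by rewrite addrCA; exact: inb.
  have inbe (p q : R) : 0 <= p <= h -> 0 <= q <= h -> ball x e (p *: a + (q *: b + x)).
    by move=> ph qh; apply: le_ball de _ _; exact: inb'.
  have z0 : 0 <= (0 : R) <= h by rewrite lexx ltW.
  pose G y := g (y + h *: b) - g y.
  have dG t : 0 <= t <= h -> differentiable G (t *: a + x).
    move=> th; apply: differentiableB.
      apply: (@differentiable_comp _ _ _ _ (fun y => y + h *: b) g) => //.
      by apply: dif => //; rewrite -addrA [x + _]addrC; exact: inbe.
    apply: dif => //; have := inbe _ 0 th z0; by rewrite scale0r add0r.
  have [c /andP[c0 ch] E] := mean_value_line h0 dG.
  have hc : 0 <= c <= h by rewrite !ltW.
  have sDg := smooth_derive a sg.
  have dD t : 0 <= t <= h -> differentiable ('D_a g) (t *: b + (c *: a + x)).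
    by move=> th; apply: dif => //; rewrite addrCA; exact: inbe.
  have [c' /andP[c'0 c'h] E'] := mean_value_line h0 dD.
  exists (c *: a + (c' *: b + x)); first by apply: inb' => //; rewrite !ltW.
  rewrite [c *: a + (_ + x)]addrCA -E'.
  have -> : 'D_a g (h *: b + (c *: a + x)) - 'D_a g (c *: a + x)
      = 'D_a G (c *: a + x).
    have d1 : differentiable g (c *: a + x + h *: b).
      by apply: dif => //; rewrite -addrA [x + _]addrC; exact: inbe.
    have d2 : differentiable g (c *: a + x).
      by apply: dif => //; have := inbe _ 0 hc z0; rewrite scale0r add0r.
    have d3 : differentiable (fun y => g (y + h *: b)) (c *: a + x).
      exact: (@differentiable_comp _ _ _ _ (fun y => y + h *: b) g).
    rewrite deriveB; [|exact: diff_derivable..].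
    congr (_ - _); rewrite /derive addrC.
    by under [in RHS]eq_fun do rewrite /= -addrA.
  by rewrite -E /G -!addrA ![x + h *: b]addrC.
apply/eqP; rewrite -subr_eq0 -normr_le0; apply/ler_addgt0Pl => eps eps0.
rewrite addr0.
have e20 : 0 < eps / 2 by rewrite divr_gt0.
have c1 := smooth_derive u (smooth_derive v sf).
have c2 := smooth_derive v (smooth_derive u sf).
have /cvgrPdist_lt/(_ _ e20)/nbhs_ballP[d1 /= d10 D1] := c1 0%N _ Ux.
have /cvgrPdist_lt/(_ _ e20)/nbhs_ballP[d2 /= d20 D2] := c2 0%N _ Ux.
pose d := Num.min e (Num.min d1 d2).
have d0 : 0 < d by rewrite !lt_min e0 d10.
have de : d <= e by rewrite ge_min lexx.
have [y1 by1 E1] := second u v f (or_introl (conj erefl erefl)) sf d d0 de.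
have [y2 by2 E2] := second v u f (or_intror (conj erefl erefl)) sf d d0 de.
(* The two orders give equal mixed derivatives, but at possibly different points [y1] and [y2];
   continuity at [x] closes the gap. *)
have E : 'D_u ('D_v f) y2 = 'D_v ('D_u f) y1.
  have hn : d / K != 0 by rewrite gt_eqF // divr_gt0.
  apply: (mulfI hn); apply: (mulfI hn).
  apply: (etrans (esym E2)); apply: etrans E1.
  have -> : (d / K) *: v + ((d / K) *: u + x) = (d / K) *: u + ((d / K) *: v + x).
    by rewrite addrCA.
  by ring.
have b1 : ball x d2 y1 by apply: le_ball by1; rewrite !ge_min lexx !orbT.
have b2 : ball x d1 y2 by apply: le_ball by2; rewrite !ge_min lexx !orbT.
rewrite -(subrKA ('D_u ('D_v f) y2)) {2}E [in leRHS](splitr eps).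
apply: (le_trans (ler_normD _ _)); apply: lerD; apply: ltW; first exact: D1.
by rewrite distrC; exact: D2.
Qed.

End MeanValue.

(** * Matrix-valued maps, determinants and inverses *)

Section Entries.
Variables (R : realType) (V : normedModType R).

Lemma derive_entry p q (F : V -> 'M[R]_(p, q)) v x i j :
  differentiable F x -> 'D_v (fun y => F y i j) x = ('D_v F x) i j.
Proof. by move=> dF; rewrite derive_mx ?mxE //; exact: diff_derivable. Qed.

Lemma smooth_entry p q (U : set V) (F : V -> 'M[R]_(p, q)) i j :
  open U -> smooth_on U F -> smooth_on U (fun x => F x i j).
Proof.
move=> oU sF k; move: (sF k); elim: k F {sF} => [|k IH] F /=.
  move=> cF x Ux; apply: (@continuous_comp _ _ _ F (fun N => N i j)).
    exact: cF.
  exact: coord_continuous.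
move=> [dF CF]; split=> [x Ux|v].
  apply: (@differentiable_comp _ _ _ _ F (fun N : 'M[R]_(p, q) => N i j)).
    exact: dF.
  exact: differentiable_coord.
apply: (Ck_ext oU _ (IH _ (CF v))) => x Ux.
by rewrite derive_entry //; exact: dF.
Qed.

Lemma derive_comm_mx p q (U : set V) (F : V -> 'M[R]_(p, q)) u v x :
  open U -> smooth_on U F -> U x -> 'D_u ('D_v F) x = 'D_v ('D_u F) x.
Proof.
move=> oU sF Ux; apply/matrixP => i j.
have E a b : ('D_a ('D_b F) x) i j = 'D_a ('D_b (fun y => F y i j)) x.
  rewrite -derive_entry; last first.
    by apply: smooth_differentiable Ux; exact: smooth_derive.
  apply: near_eq_derive; apply: filterS (open_nbhs_nbhs (conj oU Ux)) => y Uy.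
  by rewrite derive_entry //; exact: smooth_differentiable sF Uy.
apply: (etrans (E u v)); apply: (etrans _ (esym (E v u))).
exact: (derive_comm _ _ oU (smooth_entry i j oU sF) Ux).
Qed.

Lemma smooth_det n (U : set V) (F : V -> 'M[R]_n) :
  open U -> (forall i j, smooth_on U (fun x => F x i j)) ->
  smooth_on U (fun x => \det (F x)).
Proof.
move=> oU sF; rewrite /determinant.
apply: smooth_sum => // s; apply: smoothM => //; first exact: smooth_cst.
by apply: smooth_prod => // i; exact: sF.
Qed.

(** Cramer's rule: each entry is a cofactor divided by the determinant. *)
Lemma smooth_invmx n (U : set V) (F : V -> 'M[R]_n) i j :
  open U -> smooth_on U F -> (forall x, U x -> F x \in unitmx) ->
  smooth_on U (fun x => invmx (F x) i j).
Proof.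
move=> oU sF uF.
have sFe k l := smooth_entry k l oU sF.
apply: (smooth_ext oU (F := fun x => (\det (F x))^-1 * cofactor (F x) j i)).
  by move=> x Ux; rewrite /invmx uF // !mxE.
apply: smoothM => //.
  apply: smooth_inv => //; first exact: smooth_det.
  by move=> x /uF; rewrite unitmxE unitfE.
rewrite /cofactor; apply: smoothM => //; first exact: smooth_cst.
apply: smooth_det => // k l.
by under eq_fun do rewrite !mxE; exact: sFe.
Qed.

End Entries.

(** * Calculus of the Euclidean scalar product *)

Section Dot.
Variables (R : realType) (d : nat).
Implicit Types u v w : 'rV[R]_d.

Lemma mulmx_tr u v : u *m v^T = (dot u v)%:M.
Proof. exact: mx11_scalar. Qed.

Lemma dotC u v : dot u v = dot v u.
Proof. by rewrite !dotE; apply: eq_bigr => j _; rewrite mulrC. Qed.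

Lemma dotDl u v w : dot (u + v) w = dot u w + dot v w.
Proof. exact: linearDl. Qed.

Lemma dotZl c u v : dot (c *: u) v = c * dot u v.
Proof. exact: (linearZl_LR (@dot R d)). Qed.

Lemma dot0l v : dot 0 v = 0.
Proof. by rewrite /dot mul0mx mxE. Qed.

Lemma dotNl u v : dot (- u) v = - dot u v.
Proof. by rewrite -scaleN1r dotZl mulN1r. Qed.

Lemma dotBl u v w : dot (u - v) w = dot u w - dot v w.
Proof. by rewrite dotDl dotNl. Qed.

Lemma dotDr u v w : dot w (u + v) = dot w u + dot w v.
Proof. by rewrite !(dotC w) dotDl. Qed.

Lemma dotZr c u v : dot v (c *: u) = c * dot v u.
Proof. by rewrite !(dotC v) dotZl. Qed.

Lemma dot0r v : dot v 0 = 0. Proof. by rewrite dotC dot0l. Qed.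

Lemma dotNr u v : dot v (- u) = - dot v u.
Proof. by rewrite !(dotC v) dotNl. Qed.

Lemma dotBr u v w : dot w (u - v) = dot w u - dot w v.
Proof. by rewrite dotDr dotNr. Qed.

Lemma dot_suml (I : Type) (s : seq I) (P : pred I) (F : I -> 'rV[R]_d) v :
  dot (\sum_(i <- s | P i) F i) v = \sum_(i <- s | P i) dot (F i) v.
Proof. by apply: (big_morph (fun u => dot u v)) => [u w|]; rewrite ?dotDl ?dot0l. Qed.

(** Discards the Christoffel terms of a covariant Hessian that is paired with a vector orthogonal to
    all first derivatives. *)
Lemma dot_orth m u v (c : 'I_m -> R) (w : 'I_m -> 'rV[R]_d) :
  (forall k, dot (w k) v = 0) -> dot (u - \sum_k c k *: w k) v = dot u v.
Proof.
move=> wv; rewrite dotBl dot_suml big1 ?subr0 // => k _.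
by rewrite dotZl wv mulr0.
Qed.

Lemma dot_ge0 u : 0 <= dot u u.
Proof. by rewrite dotE sumr_ge0 // => j _; rewrite -expr2 sqr_ge0. Qed.

Lemma dot_eq0 u : (dot u u == 0) = (u == 0).
Proof.
apply/eqP/eqP => [|->]; last exact: dot0l.
rewrite dotE => /eqP; rewrite psumr_eq0; last first.
  by move=> j _; rewrite -expr2 sqr_ge0.
move=> /allP h; apply/rowP => j; rewrite mxE.
have /implyP/(_ isT) := h j (mem_index_enum j).
by rewrite -expr2 sqrf_eq0 => /eqP.
Qed.

Lemma enorm_sqr u : enorm u ^+ 2 = dot u u.
Proof. by rewrite sqr_sqrtr // dot_ge0. Qed.

Lemma dot_mulmxl e u (A : 'M[R]_(d, e)) (v : 'rV[R]_e) :
  dot (u *m A) v = dot u (v *m A^T).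
Proof. by rewrite /dot trmx_mul trmxK mulmxA. Qed.

End Dot.

Lemma dot_row_mx (R : realType) d1 d2 (u1 v1 : 'rV[R]_d1) (u2 v2 : 'rV[R]_d2) :
  dot (row_mx u1 u2) (row_mx v1 v2) = dot u1 v1 + dot u2 v2.
Proof. by rewrite /dot tr_row_mx mul_row_col mxE. Qed.

(** * Traces of bilinear forms with respect to a metric *)

Section Trace.
Variables (R : realType) (m : nat).
Implicit Types G g : 'M[R]_m.

Definition gtrace (W : lmodType R) G (T : 'I_m -> 'I_m -> W) : W :=
  \sum_i \sum_j G i j *: T i j.

Lemma gtraceE (W : lmodType R) G (T : 'I_m -> 'I_m -> W) :
  gtrace G T = \sum_i \sum_j G i j *: T i j.
Proof. by []. Qed.

Lemma gtraceD (W : lmodType R) G (S T : 'I_m -> 'I_m -> W) :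
  gtrace G (fun i j => S i j + T i j) = gtrace G S + gtrace G T.
Proof.
rewrite /gtrace -big_split; apply: eq_bigr => i _ /=.
by rewrite -big_split; apply: eq_bigr => j _ /=; rewrite scalerDr.
Qed.

Lemma gtraceZ (W : lmodType R) G c (T : 'I_m -> 'I_m -> W) :
  gtrace G (fun i j => c *: T i j) = c *: gtrace G T.
Proof.
rewrite /gtrace scaler_sumr; apply: eq_bigr => i _ /=.
rewrite scaler_sumr; apply: eq_bigr => j _ /=.
by rewrite !scalerA mulrC.
Qed.

Lemma gtraceB (W : lmodType R) G (S T : 'I_m -> 'I_m -> W) :
  gtrace G (fun i j => S i j - T i j) = gtrace G S - gtrace G T.
Proof.
rewrite gtraceD -scaleN1r -gtraceZ; congr (_ + _).
by apply: eq_bigr => i _; apply: eq_bigr => j _; rewrite scaleN1r.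
Qed.

Lemma eq_gtrace (W : lmodType R) G (S T : 'I_m -> 'I_m -> W) :
  (forall i j, S i j = T i j) -> gtrace G S = gtrace G T.
Proof. by move=> E; apply: eq_bigr => i _; apply: eq_bigr => j _; rewrite E. Qed.

Lemma gtrace0 (W : lmodType R) G (T : 'I_m -> 'I_m -> W) :
  (forall i j, T i j = 0) -> gtrace G T = 0.
Proof.
by move=> T0; rewrite /gtrace big1 // => i _; rewrite big1 // => j _; rewrite T0 scaler0.
Qed.

Lemma gtrace_flip (W : lmodType R) G (T : 'I_m -> 'I_m -> W) :
  (forall i j, G i j = G j i) -> gtrace G (fun i j => T j i) = gtrace G T.
Proof.
move=> Gs; rewrite /gtrace exchange_big; apply: eq_bigr => i _.
by apply: eq_bigr => j _; rewrite Gs.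
Qed.

Lemma gtrace_raddf (W W' : lmodType R) (L : {linear W -> W'}) G
    (T : 'I_m -> 'I_m -> W) :
  L (gtrace G T) = gtrace G (fun i j => L (T i j)).
Proof.
rewrite /gtrace linear_sum; apply: eq_bigr => i _; rewrite linear_sum.
by apply: eq_bigr => j _; rewrite linearZ.
Qed.

Lemma dot_gtrace d G (T : 'I_m -> 'I_m -> 'rV[R]_d) u :
  dot (gtrace G T) u = gtrace G (fun i j => (dot (T i j) u : R^o)).
Proof.
rewrite /gtrace dot_suml; apply: eq_bigr => i _; rewrite dot_suml.
by apply: eq_bigr => j _; rewrite dotZl.
Qed.

Lemma gtrace_metric (W : lmodType R) g (w : W) :
  g \in unitmx -> g^T = g ->
  gtrace (invmx g) (fun i j => g i j *: w) = m%:R *: w.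
Proof.
move=> ug gs; rewrite /gtrace.
transitivity (\sum_(i < m) w); last first.
  by rewrite sumr_const card_ord scaler_nat.
apply: eq_bigr => i _.
transitivity ((\sum_j invmx g i j * g j i) *: w).
  rewrite scaler_suml; apply: eq_bigr => j _.
  by rewrite scalerA; congr ((_ * _) *: _); rewrite -{1}gs mxE.
have := congr1 (fun A : 'M[R]_m => A i i) (mulVmx ug).
by rewrite !mxE eqxx => ->; rewrite scale1r.
Qed.

(** [v c] lists the [c]-th coordinates of the vectors [w i]. The trace is the sum over [c] of the
    squared lengths of these covectors for the inverse metric; raising the index turns each into a
    [g]-length, to which positivity applies. *)
Lemma gtrace_gram_ge0 d g (w : 'I_m -> 'rV[R]_d) :
  g \in unitmx -> g^T = g ->
  (forall v : 'rV[R]_m, v != 0 -> 0 < (v *m g *m v^T) 0 0) ->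
  0 <= (gtrace (invmx g) (fun i j => (dot (w i) (w j) : R^o)) : R) ?=
    iff [forall i, w i == 0].
Proof.
move=> ug gs pg; pose v c : 'rV[R]_m := \row_i w i 0 c.
have GT : (invmx g)^T = invmx g by rewrite trmx_inv gs.
have E : gtrace (invmx g) (fun i j => (dot (w i) (w j) : R^o)) =
    \sum_c ((v c *m invmx g) *m g *m (v c *m invmx g)^T) 0 0.
  transitivity (\sum_c \sum_i \sum_j v c 0 i * invmx g i j * v c 0 j).
    rewrite exchange_big; apply: eq_bigr => i _; rewrite exchange_big.
    apply: eq_bigr => j _; rewrite dotE scaler_sumr; apply: eq_bigr => c _.
    by rewrite !mxE /GRing.scale /= mulrA [invmx g i j * _]mulrC.
  apply: eq_bigr => c _; rewrite trmx_mul GT mulmxKV // mulmxA mxE exchange_big.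
  apply: eq_bigr => j _; rewrite !mxE mulr_suml.
  by apply: eq_bigr => i _.
have nn c : 0 <= ((v c *m invmx g) *m g *m (v c *m invmx g)^T) 0 0.
  have [->|n0] := eqVneq (v c *m invmx g) 0; first by rewrite !mul0mx mxE.
  exact/ltW/pg.
rewrite E; split; first exact: sumr_ge0.
rewrite eq_sym psumr_eq0 //; apply/allP/forallP => [h i|h c _].
  apply/eqP/rowP => c; have := h c (mem_index_enum c); rewrite /=.
  have [v0 _|n0] := eqVneq (v c *m invmx g) 0; last by rewrite gt_eqF // pg.
  have : v c = 0 by rewrite -(mulmxKV ug (v c)) v0 mul0mx.
  by move=> /rowP/(_ i); rewrite !mxE.
have -> : v c = 0 by apply/rowP => i; rewrite !mxE (eqP (h i)) mxE.
by rewrite !mul0mx mxE /=.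
Qed.

(** Expansion of the square: both cross terms are traces of [b], one of them transposed, which is
    harmless since the inverse metric is symmetric. *)
Lemma gtrace_gram_shift d g (b : 'I_m -> 'I_m -> R^o)
    (t e : 'I_m -> 'rV[R]_d) c :
  g \in unitmx -> g^T = g ->
  (forall i j, dot (e i) (e j) = g i j) ->
  (forall i j, dot (t i) (e j) = - b i j) ->
  gtrace (invmx g) (fun i j => dot (t i + c *: e i) (t j + c *: e j) : R^o) =
  gtrace (invmx g) (fun i j => dot (t i) (t j) : R^o)
    - c *: gtrace (invmx g) b *+ 2 + c ^+ 2 * m%:R.
Proof.
move=> ug gs ee te.
have GT : (invmx g)^T = invmx g by rewrite trmx_inv gs.
have E i j : dot (t i + c *: e i) (t j + c *: e j) =
    (dot (t i) (t j) - c *: b i j) + (c ^+ 2 *: (g i j *: 1) - c *: b j i) :> R^o.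
  rewrite dotDl !dotDr !dotZl !dotZr ee te [dot (e i) (t j)]dotC te.
  by rewrite /GRing.scale /=; ring.
rewrite (eq_gtrace _ E) gtraceD !gtraceB !gtraceZ.
rewrite (gtrace_flip b); last by move=> i j; rewrite -{1}GT mxE.
by rewrite gtrace_metric // /GRing.scale /=; ring.
Qed.

(* The difference of the two sides is the squared norm of [t i + (s / m) e i]. *)
Lemma gtrace_gram_eq d g (b : 'I_m -> 'I_m -> R^o) (t e : 'I_m -> 'rV[R]_d)
    (s := gtrace (invmx g) b : R) :
  g \in unitmx -> g^T = g ->
  (forall v : 'rV[R]_m, v != 0 -> 0 < (v *m g *m v^T) 0 0) ->
  (forall i j, dot (e i) (e j) = g i j) ->
  (forall i j, dot (t i) (e j) = - b i j) ->
  gtrace (invmx g) (fun i j => dot (t i) (t j) : R^o) = s ^+ 2 / m%:R <->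
  forall i, t i = - (s / m%:R) *: e i.
Proof.
move=> ug gs pg ee te.
have [_] := gtrace_gram_ge0 (fun i => t i + (s / m%:R) *: e i) ug gs pg.
rewrite (gtrace_gram_shift _ ug gs ee te) -/s eq_sym.
set P := gtrace _ _.
have -> : P - (s / m%:R) *: s *+ 2 + (s / m%:R) ^+ 2 * m%:R = P - s ^+ 2 / m%:R.
  rewrite /GRing.scale /=.
  (* For [m = 0] the convention 1/0 = 0 makes both sides equal to [P]. *)
  have [->|m0] := eqVneq (m%:R : R) 0; first by rewrite invr0; ring.
  by field.
rewrite subr_eq0 => E; split => [PE|h].
  move: E; rewrite PE eqxx => /esym/forallP h i.
  by have := h i; rewrite addr_eq0 scaleNr => /eqP.
apply/eqP; rewrite E; apply/forallP => i.
by rewrite h scaleNr addNr.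
Qed.

End Trace.
(** * Immersions into a sphere *)

Section SphereCurvature.
Variables (R : realType) (d : nat).
Implicit Types (u v w y z h : 'rV[R]_d).

Lemma tan_projB y u v : tan_proj y (u - v) = tan_proj y u - tan_proj y v.
Proof. by rewrite /tan_proj dotBl mulrBl scalerBl opprD addrACA -opprD. Qed.

Lemma tan_projZ y c u : tan_proj y (c *: u) = c *: tan_proj y u.
Proof. by rewrite /tan_proj dotZl scalerBr scalerA mulrA. Qed.

Lemma tan_proj_id y u : dot u y = 0 -> tan_proj y u = u.
Proof. by move=> uy; rewrite /tan_proj uy mul0r scale0r subr0. Qed.

Lemma tan_proj_self y : tan_proj y y = 0.
Proof.
have [->|y0] := eqVneq y 0; first by rewrite /tan_proj scaler0 subr0.
by rewrite /tan_proj divff ?scale1r ?subrr // dot_eq0.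
Qed.

Lemma dot_tan_proj y u : dot (tan_proj y u) y = 0.
Proof.
have [->|y0] := eqVneq y 0; first exact: dot0r.
by rewrite /tan_proj dotBl dotZl divfK ?subrr // dot_eq0.
Qed.

Let ratio w z : R := dot w z * (dot z z)^-1.

Lemma differentiable_dot_cst w z : differentiable (dot w) z.
Proof.
apply: (@differentiable_bilinear _ _ _ _ _ (@dot R d) (@dot_continuous R d)
  (fun _ => w) id); [exact: differentiable_cst|exact: ex_diff].
Qed.

Lemma differentiable_inv_dot z :
  z != 0 -> differentiable (fun z => (dot z z)^-1) z.
Proof.
move=> z0; apply: differentiableV; last by rewrite dot_eq0.
by apply: (@differentiable_bilinear _ _ _ _ _ (@dot R d) (@dot_continuous R d)
  id id); exact: ex_diff.
Qed.

Lemma differentiable_ratio w z : z != 0 -> differentiable (ratio w) z.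
Proof.
move=> z0; apply: differentiableM; first exact: differentiable_dot_cst.
exact: differentiable_inv_dot.
Qed.

Lemma differentiable_ratio_scale w z :
  z != 0 -> differentiable (fun y => ratio w y *: y) z.
Proof.
move=> z0; apply: (@differentiable_bilinear _ _ _ _ _ (@GRing.scale R _)
    (@scale_bilinear_continuous R _) (ratio w) id); last exact: ex_diff.
exact: differentiable_ratio.
Qed.

Lemma differentiable_tangent_extension w z :
  z != 0 -> differentiable (tangent_extension w) z.
Proof.
move=> z0; apply: (differentiableB (f := fun _ => w)).
  exact: differentiable_cst.
exact: differentiable_ratio_scale.
Qed.

Lemma derive_tangent_extension w h z : z != 0 ->
  'D_h (tangent_extension w) z = - ('D_h (ratio w) z *: z + ratio w z *: h).
Proof.
move=> z0; rewrite /tangent_extension /tan_proj.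
rewrite (deriveB (f := fun _ => w) (g := fun y => ratio w y *: y)); last 2 first.
- exact: derivable_cst.
- exact/diff_derivable/differentiable_ratio_scale.
rewrite derive_cst sub0r (derive_scale (c := ratio w) (F := id)) //.
  by rewrite derive_id.
exact: differentiable_ratio.
Qed.

(** The derivative of [ratio w] enters only through a multiple of [z], which the projection
    kills. *)
Lemma tan_proj_derive_extension w h z : z != 0 ->
  tan_proj z ('D_h (tangent_extension w) z) = - ratio w z *: tan_proj z h.
Proof.
move=> z0; rewrite derive_tangent_extension // opprD tan_projB.
rewrite -scaleNr !tan_projZ tan_proj_self scaler0 sub0r scaleNr.
by [].
Qed.

Lemma sphere_nabla_extension v w z : z != 0 ->
  sphere_nabla (tangent_extension v) (tangent_extension w) z =
  - ratio w z *: tangent_extension v z.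
Proof.
move=> z0; rewrite /sphere_nabla tan_proj_derive_extension //; congr (_ *: _).
by rewrite tan_proj_id // dot_tan_proj.
Qed.

(** As [w] is tangent, [ratio w] vanishes at [y], and only its derivative along [u], namely <u, w> /
    <y, y>, contributes. *)
Lemma sphere_nabla2_extension u v w y : y != 0 ->
  dot u y = 0 -> dot v y = 0 -> dot w y = 0 ->
  sphere_nabla (tangent_extension u)
    (sphere_nabla (tangent_extension v) (tangent_extension w)) y =
  - (dot u w / dot y y) *: v.
Proof.
move=> y0 uy vy wy; rewrite /sphere_nabla -/(sphere_nabla _ _).
have -> : tangent_extension u y = u by exact: tan_proj_id.
have -> : 'D_u (sphere_nabla (tangent_extension v) (tangent_extension w)) y =
    'D_u (fun z => - ratio w z *: tangent_extension v z) y.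
  apply: near_eq_derive.
  have y_neq0 : \forall z \near y, z != 0 
    by apply: (@cvgr_neq0 _ _ _ (nbhs y) _ id y); [exact: cvg_id|].
  by apply: filterS y_neq0 => z; exact: sphere_nabla_extension.
rewrite (derive_scale (c := fun z => - ratio w z)); last 2 first.
- by apply: differentiableN; exact: differentiable_ratio.
- exact: differentiable_tangent_extension.
rewrite {2}/ratio wy mul0r oppr0 scale0r addr0.
rewrite (deriveN (f := ratio w)); last exact/diff_derivable/differentiable_ratio.
rewrite (derive_scale (c := dot w) (F := fun z => (dot z z)^-1)); last 2 first.
- exact: differentiable_dot_cst.
- exact: differentiable_inv_dot.
rewrite wy scale0r addr0 (derive_dot (F := fun _ => w) (G := id)) //.
rewrite derive_cst dot0l add0r derive_id.
rewrite tan_projZ [tangent_extension v y]tan_proj_id // tan_proj_id //.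
by rewrite dotC.
Qed.

(** Constant curvature 1 / |y|^2. The bracket need not be computed: every covariant derivative of
    the extension of [w] vanishes at [y], where [ratio w] is 0. *)
Lemma sphere_curvatureE y u v w : y != 0 ->
  dot u y = 0 -> dot v y = 0 -> dot w y = 0 ->
  sphere_curvature y u v w =
  (dot v w / dot y y) *: u - (dot u w / dot y y) *: v.
Proof.
move=> y0 uy vy wy; rewrite /sphere_curvature /curvature_op.
rewrite !sphere_nabla2_extension // [X in _ - X]/sphere_nabla.
rewrite tan_proj_derive_extension // /ratio wy mul0r oppr0 scale0r subr0.
by rewrite !scaleNr opprK addrC.
Qed.

End SphereCurvature.
(* Otherwise failing unification problems between partial derivatives are
   pushed down to the filters that define limits. *)
#[local] Opaque derive dot.

(** * The Laplacian in a chart *)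

Section Laplacian.
Variables (R : realType) (m d : nat) (M : riemannian R m) (a : chart M).
Implicit Types (i j k l : 'I_m) (x : 'rV[R]_m) (V : 'rV[R]_m -> 'rV[R]_d).

Lemma open_img : open (img a).
Proof. exact: img_open. Qed.
Hint Resolve open_img : core.

Lemma near_img x : img a x -> \forall y \near x, img a y.
Proof. by move=> Ux; apply: open_nbhs_nbhs; split. Qed.

Lemma metric_unit x : img a x -> metric a x \in unitmx.
Proof.
move=> Ux; rewrite -row_free_unit -kermx_eq0; apply/eqP/row_matrixP => i.
rewrite row0; apply/eqP/contraT => v0.
have := metric_pos Ux v0.
by rewrite -row_mul mulmx_ker row0 mul0mx mxE ltxx.
Qed.

Lemma inv_metric_sym x i j :
  img a x -> inv_metric a x i j = inv_metric a x j i.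
Proof.
by move=> Ux; rewrite /inv_metric -{1}(Defs.metric_sym Ux) -trmx_inv mxE.
Qed.

Lemma smooth_inv_metric i j : smooth_on (img a) (fun x => inv_metric a x i j).
Proof.
by apply: smooth_invmx => //; [exact: metric_smooth|exact: metric_unit].
Qed.

Lemma smooth_christoffel k i j : smooth_on (img a) (christoffel a k i j).
Proof.
have sg p q l : smooth_on (img a) (fun x => dmetric a l x p q).
  by apply: smooth_entry => //; apply: smooth_derive; exact: metric_smooth.
apply: smoothM => //; first exact: smooth_cst.
apply: smooth_sum => // l; apply: smoothM => //; first exact: smooth_inv_metric.
by apply: smoothB => //; apply: smoothD.
Qed.

(** The Laplace-Beltrami operator on each Euclidean coordinate, with the sign of the trace of the
    Hessian and, unlike [rough_laplacian], without projection to the sphere. *)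
Definition laplacian V x : 'rV[R]_d :=
  gtrace (inv_metric a x) (fun i j =>
    partial i (partial j V) x - \sum_k christoffel a k i j x *: partial k V x).

Lemma eq_partial i V W x : img a x ->
  (forall y, img a y -> V y = W y) -> partial i V x = partial i W x.
Proof.
move=> Ux E; apply: near_eq_derive.
by apply: filterS (near_img Ux) => y; exact: E.
Qed.

Lemma eq_laplacian V W x : img a x ->
  (forall y, img a y -> V y = W y) -> laplacian V x = laplacian W x.
Proof.
move=> Ux E; apply: eq_gtrace => i j.
rewrite (eq_partial i Ux (fun y Uy => eq_partial j Uy E)).
by under eq_bigr do rewrite (eq_partial _ Ux E).
Qed.

Lemma smooth_partial i V : smooth_on (img a) V -> smooth_on (img a) (partial i V).
Proof. exact: smooth_derive. Qed.

Lemma smooth_laplacian V : smooth_on (img a) V -> smooth_on (img a) (laplacian V).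
Proof.
move=> sV; apply: smooth_sum => // i; apply: smooth_sum => // j.
apply: smooth_scale => //; first exact: smooth_inv_metric.
apply: smoothB => //; first by apply: smooth_partial; exact: smooth_partial.
apply: smooth_sum => // k; apply: smooth_scale => //.
  exact: smooth_christoffel.
exact: smooth_partial.
Qed.

Lemma partialD i V W x : img a x -> smooth_on (img a) V -> smooth_on (img a) W ->
  partial i (fun y => V y + W y) x = partial i V x + partial i W x.
Proof.
move=> Ux sV sW; rewrite /partial (deriveD (f := V) (g := W)) //.
- exact/diff_derivable/(smooth_differentiable sV).
- exact/diff_derivable/(smooth_differentiable sW).
Qed.

Lemma partialZ i c V x : img a x -> smooth_on (img a) V ->
  partial i (fun y => c *: V y) x = c *: partial i V x.
Proof.
move=> Ux sV; rewrite /partial (deriveZ (f := V)) //.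
exact/diff_derivable/(smooth_differentiable sV).
Qed.

Lemma laplacian_lin c V W x :
  img a x -> smooth_on (img a) V -> smooth_on (img a) W ->
  laplacian (fun y => V y + c *: W y) x = laplacian V x + c *: laplacian W x.
Proof.
move=> Ux sV sW; rewrite /laplacian -gtraceZ -gtraceD; apply: eq_gtrace => i j.
have scW : smooth_on (img a) (fun y => c *: W y).
  by apply: smooth_scale => //; exact: smooth_cst.
have E k y : img a y -> partial k (fun y => V y + c *: W y) y =
    partial k V y + c *: partial k W y.
  by move=> Uy; rewrite partialD // partialZ.
rewrite (eq_partial i Ux (E j)) partialD //; last 2 first.
- exact: smooth_partial.
- by apply: smooth_scale; [|exact: smooth_cst|exact: smooth_partial].
rewrite partialZ //; last exact: smooth_partial.
rewrite scalerBr addrACA -opprD; congr (_ - _).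
rewrite scaler_sumr -big_split; apply: eq_bigr => k _ /=.
by rewrite E // scalerDr !scalerA [c * _]mulrC.
Qed.

(** Moves a derivative from one factor to the other; the orthogonality relations below are
    differentiated in this way. *)
Lemma partial_dot_const V W (c : R) x : img a x ->
  smooth_on (img a) V -> smooth_on (img a) W ->
  (forall y, img a y -> dot (V y) (W y) = c) ->
  forall i, dot (partial i V x) (W x) = - dot (V x) (partial i W x).
Proof.
move=> Ux sV sW E i; apply/eqP; rewrite -addr_eq0.
rewrite -derive_dot; [|exact: smooth_differentiable sV Ux
                      |exact: smooth_differentiable sW Ux].
apply/eqP; rewrite -[RHS](derive_cst c x (delta_mx 0 i : 'rV[R]_m)).
by apply: near_eq_derive; apply: filterS (near_img Ux) => y; exact: E.
Qed.

End Laplacian.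

Lemma laplacian_mulmxr (R : realType) m d e (M : riemannian R m) (a : chart M)
    (V : 'rV[R]_m -> 'rV[R]_d) (A : 'M[R]_(d, e)) x :
  img a x -> smooth_on (img a) V ->
  laplacian a (fun y => V y *m A) x = laplacian a V x *m A.
Proof.
move=> Ux sV.
have E (W : 'rV[R]_m -> 'rV[R]_d) k y : img a y -> smooth_on (img a) W ->
    partial k (fun y => W y *m A) y = partial k W y *m A.
  move=> Uy sW; apply: (derive_linl (mulmxr A)).
  exact: smooth_differentiable sW Uy.
rewrite -[RHS]/(mulmxr A _) gtrace_raddf; apply: eq_gtrace => i j.
rewrite /= mulmxBl (eq_partial i Ux (fun y Uy => E V j y Uy sV)).
rewrite E //; last exact: smooth_partial.
congr (_ - _); rewrite mulmx_suml; apply: eq_bigr => k _.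
by rewrite E // scalemxAl.
Qed.

(** * Fundamental equations of an immersion into a sphere *)

Section Immersion.
Variables (R : realType) (m d : nat) (M : riemannian R m) (f : M -> 'rV[R]_d).
Variables (r : R) (r0 : 0 < r) (imm : isometric_immersion f r) (a : chart M).
Implicit Types (i j k l : 'I_m) (x : 'rV[R]_m) (V : 'rV[R]_m -> 'rV[R]_d).

Local Notation U := (img a).
Local Notation F := (local_map f a).

Let oU : open U. Proof. exact: open_img. Qed.
Hint Resolve oU : core.

Lemma smooth_local_map : smooth_on U F.
Proof. by have [_ /(_ a) []] := imm. Qed.
Hint Resolve smooth_local_map : core.

Lemma smooth_dmap i : smooth_on U (dmap f a i).
Proof. exact: smooth_partial. Qed.
Hint Resolve smooth_dmap : core.

Lemma dot_dmap i j x : U x -> dot (dmap f a i x) (dmap f a j x) = metric a x i j.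
Proof. by move=> Ux; have [_ /(_ a) [_ /(_ _ Ux) [_]]] := imm; exact. Qed.

Lemma dot_map x : dot (F x) (F x) = r ^+ 2.
Proof.
have [sf _] := imm; have := sf (param a x); rewrite /sphere /= => <-.
by rewrite enorm_sqr.
Qed.

Lemma dot_dmap_map i x : U x -> dot (dmap f a i x) (F x) = 0.
Proof.
move=> Ux; have := partial_dot_const Ux smooth_local_map smooth_local_map
  (fun y _ => dot_map y) i.
rewrite [in RHS]dotC -/(dmap f a i x) => /eqP.
by rewrite -addr_eq0 -mulr2n mulrn_eq0 /= => /eqP.
Qed.

Lemma dot_hess_map i j x : U x ->
  dot (partial i (dmap f a j) x) (F x) = - metric a x i j.
Proof.
move=> Ux; rewrite (partial_dot_const (c := 0) Ux) //.
  by rewrite -/(dmap f a i x) dotC dot_dmap.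
by move=> y Uy; rewrite dot_dmap_map.
Qed.

Lemma hess_sym i j x : U x -> partial i (dmap f a j) x = partial j (dmap f a i) x.
Proof.
by move=> Ux; exact: (derive_comm_mx _ _ (@open_img _ _ _ a) smooth_local_map Ux).
Qed.

Lemma dmetricE l i j x : U x -> dmetric a l x i j =
  dot (partial l (dmap f a i) x) (dmap f a j x) +
  dot (dmap f a i x) (partial l (dmap f a j) x).
Proof.
move=> Ux; rewrite /dmetric -derive_entry; last first.
  by apply: smooth_differentiable Ux; exact: metric_smooth.
rewrite -derive_dot; [|exact: smooth_differentiable (smooth_dmap _) Ux..].
apply: near_eq_derive; apply: filterS (near_img Ux) => y Uy.
by rewrite dot_dmap.
Qed.

(** The algebra of the Koszul formula. The [u] vectors stand for first and the [h] vectors for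
    second derivatives of the immersion; symmetry of the latter cancels four of the six terms. *)
Lemma koszul (ui uj ul hij hil hjl hji hli hlj : 'rV[R]_d) (c1 c2 c3 : R) :
  c1 = dot hij ul + dot uj hil -> c2 = dot hji ul + dot ui hjl ->
  c3 = dot hli uj + dot ui hlj -> hli = hil -> hlj = hjl -> hji = hij ->
  2^-1 * (c1 + c2 - c3) = dot hij ul.
Proof. by move=> -> -> -> -> -> ->; rewrite (dotC uj); field. Qed.

(** The connection of the induced metric is the tangential part of flat differentiation: lowering
    the index cancels the inverse metric, and the Koszul formula does the rest. *)
Lemma christoffel_lower i j l x : U x ->
  \sum_k christoffel a k i j x * metric a x k l =
  dot (partial i (dmap f a j) x) (dmap f a l x).
Proof.
move=> Ux; pose C l := dmetric a i x j l + dmetric a j x i l - dmetric a l x i j.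
transitivity (2^-1 * \sum_l' (\sum_k metric a x l k * inv_metric a x k l') * C l').
  rewrite [in RHS]mulr_sumr; under [in RHS]eq_bigr do rewrite mulr_suml mulr_sumr.
  rewrite exchange_big; apply: eq_bigr => k _.
  rewrite /christoffel -mulrA mulr_suml mulr_sumr; apply: eq_bigr => l' _.
  congr (_ * _); rewrite -/(C l') mulrC mulrA; congr (_ * _ * _).
  by rewrite -{1}(Defs.metric_sym Ux) mxE.
have E l' : \sum_k metric a x l k * inv_metric a x k l' = (l == l')%:R.
  by have /matrixP/(_ l l') := mulmxV (metric_unit Ux); rewrite !mxE.
under eq_bigr do rewrite E.
rewrite (bigD1 l) //= big1 ?addr0 => [|l' ll']; last first.
  by rewrite eq_sym (negbTE ll') mul0r.
rewrite eqxx mul1r; apply: koszul (dmetricE i j l Ux) (dmetricE j i l Ux)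
  (dmetricE l i j Ux) (hess_sym l i Ux) (hess_sym l j Ux) (hess_sym j i Ux).
Qed.

(** The component removed by [tan_proj] is known from <d_i d_j F, F> = - g_ij, which comes from
    differentiating <d_j F, F> = 0. *)
Lemma second_fundamental_formE i j x : U x ->
  second_fundamental_form f a i j x =
  partial i (dmap f a j) x - \sum_k christoffel a k i j x *: dmap f a k x
  + (metric a x i j / r ^+ 2) *: F x.
Proof.
move=> Ux; rewrite /second_fundamental_form /nabla_pullback /tan_proj -/F.
by rewrite dot_hess_map // dot_map mulNr scaleNr opprK addrAC.
Qed.

Lemma dot_sff_map i j x : U x -> dot (second_fundamental_form f a i j x) (F x) = 0.
Proof.
move=> Ux; rewrite second_fundamental_formE // dotDl dotBl dot_hess_map //.
rewrite dot_suml big1 => [|k _]; last by rewrite dotZl dot_dmap_map // mulr0.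
by rewrite dotZl dot_map divfK ?subr0 ?addNr // expf_neq0 // gt_eqF.
Qed.

Lemma dot_sff_dmap i j l x : U x ->
  dot (second_fundamental_form f a i j x) (dmap f a l x) = 0.
Proof.
move=> Ux; rewrite second_fundamental_formE // dotDl dotBl dotZl.
rewrite [dot (F x) _]dotC dot_dmap_map // mulr0 addr0 -christoffel_lower //.
rewrite dot_suml -sumrB big1 // => k _.
by rewrite dotZl dot_dmap // subrr.
Qed.

Lemma tension_trace x :
  tension f a x = gtrace (inv_metric a x) (fun i j => second_fundamental_form f a i j x).
Proof.
rewrite /tension /mean_curvature scalerA -/(gtrace _ _).
(* In dimension 0 the factor [m%:R] cannot be cancelled, but the trace is then an empty sum. *)
have [m0|m_neq0] := eqVneq (m%:R : R) 0; last by rewrite mulfV ?scale1r.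
rewrite m0 mul0r scale0r /gtrace big1 // => i _.
move/eqP: m0; rewrite pnatr_eq0 => /eqP m0.
by have := ltn_ord i; rewrite {2}m0.
Qed.

Lemma tensionE x : U x ->
  tension f a x = laplacian a F x + (m%:R / r ^+ 2) *: F x.
Proof.
move=> Ux; rewrite tension_trace.
rewrite (eq_gtrace _ (fun i j => second_fundamental_formE i j Ux)).
rewrite gtraceD; congr (_ + _).
transitivity (gtrace (inv_metric a x) (fun i j => metric a x i j *: (r ^- 2 *: F x))).
  by apply: eq_gtrace => i j; rewrite scalerA.
by rewrite gtrace_metric ?scalerA //; [exact: metric_unit|exact: Defs.metric_sym].
Qed.

Lemma partial_local_map i x : partial i F x = dmap f a i x. Proof. by []. Qed.

#[local] Opaque partial dmap local_map christoffel inv_metric gtrace laplacian.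
#[local] Opaque second_fundamental_form tension.

Lemma dot_tension_map x : U x -> dot (tension f a x) (F x) = 0.
Proof.
move=> Ux; rewrite tension_trace dot_gtrace gtrace0 // => i j.
exact: dot_sff_map.
Qed.

Lemma dot_tension_dmap l x : U x -> dot (tension f a x) (dmap f a l x) = 0.
Proof.
move=> Ux; rewrite tension_trace dot_gtrace gtrace0 // => i j.
exact: dot_sff_dmap.
Qed.

Lemma smooth_tension : smooth_on U (tension f a).
Proof.
apply: (smooth_ext oU (F := fun x => laplacian a F x + (m%:R / r ^+ 2) *: F x)).
  by move=> x Ux; rewrite tensionE.
apply: smoothD => //; first exact: smooth_laplacian.
by apply: smooth_scale => //; exact: smooth_cst.
Qed.
Hint Resolve smooth_tension : core.

Lemma dot_dtension_map j x : U x -> dot (partial j (tension f a) x) (F x) = 0.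
Proof.
move=> Ux; rewrite (partial_dot_const (c := 0) Ux) //.
  by rewrite partial_local_map dot_tension_dmap // oppr0.
exact: dot_tension_map.
Qed.

(** Weingarten's formula: differentiate <tau, df> = 0; tau only sees the normal part of the second
    derivatives of [f]. *)
Lemma dot_dtension_dmap i j x : U x ->
  dot (partial i (tension f a) x) (dmap f a j x) =
  - dot (second_fundamental_form f a i j x) (tension f a x).
Proof.
move=> Ux; rewrite (partial_dot_const (c := 0) Ux) //; last first.
  by move=> y; exact: dot_tension_dmap.
congr (- _); rewrite second_fundamental_formE // dotDl dotZl.
rewrite [dot (F x) _]dotC dot_tension_map // mulr0 addr0 dot_orth.
  exact: dotC.
by move=> k; rewrite dotC; exact: dot_tension_dmap.
Qed.

Lemma dot_hess_tension_map i j x : U x ->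
  dot (partial i (partial j (tension f a)) x) (F x) =
  dot (second_fundamental_form f a j i x) (tension f a x).
Proof.
move=> Ux; rewrite (partial_dot_const (c := 0) Ux) //.
- by rewrite partial_local_map dot_dtension_dmap // opprK.
- exact: smooth_partial.
- by move=> y; exact: dot_dtension_map.
Qed.

(** The trace of <B, tau> is |tau|^2. This identity lets the biharmonic equation, paired with the
    position vector, determine the norm of the tension. *)
Lemma dot_laplacian_tension_map x : U x ->
  dot (laplacian a (tension f a) x) (F x) = dot (tension f a x) (tension f a x).
Proof.
move=> Ux.
have E i j : dot (partial i (partial j (tension f a)) x -
      \sum_k christoffel a k i j x *: partial k (tension f a) x) (F x) =
    dot (second_fundamental_form f a j i x) (tension f a x) :> R^o.
  apply: etrans (dot_hess_tension_map i j Ux); apply: dot_orth => k.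
  exact: dot_dtension_map Ux.
have -> : dot (tension f a x) (tension f a x) = gtrace (inv_metric a x)
    (fun i j => dot (second_fundamental_form f a i j x) (tension f a x) : R^o).
  by rewrite -dot_gtrace -tension_trace.
rewrite [LHS](dot_gtrace) (eq_gtrace _ E); apply: gtrace_flip => i j.
exact: inv_metric_sym.
Qed.

Lemma tension_trace_r x (T := tension f a x) :
  gtrace (inv_metric a x)
    (fun i j => dot (second_fundamental_form f a i j x) T : R^o) = dot T T.
Proof. by rewrite -dot_gtrace -tension_trace. Qed.

Lemma mean_curvatureE x : mean_curvature f a x = m%:R^-1 *: tension f a x.
Proof. by rewrite tension_trace. Qed.

(** Equality case of Cauchy-Schwarz for the tangential part of d tau, whose components are -<B,
    tau>, with trace -|tau|^2. *)
Lemma gram_dtension_eq x (s := dot (tension f a x) (tension f a x)) : U x ->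
  gtrace (inv_metric a x) (fun i j =>
    dot (partial i (tension f a) x) (partial j (tension f a) x) : R^o) =
    s ^+ 2 / m%:R <->
  forall i, partial i (tension f a) x = - (s / m%:R) *: dmap f a i x.
Proof.
move=> Ux; rewrite /s -tension_trace_r.
apply: (gtrace_gram_eq (metric_unit Ux) (Defs.metric_sym Ux)
  (fun v => @metric_pos _ _ _ _ _ v Ux)).
- by move=> i j; exact: dot_dmap Ux.
- by move=> i j; exact: dot_dtension_dmap Ux.
Qed.

Lemma partial_mean_curvature i x : U x ->
  partial i (mean_curvature f a) x = m%:R^-1 *: partial i (tension f a) x.
Proof.
move=> Ux; rewrite -(partialZ i m%:R^-1 Ux smooth_tension).
by apply: eq_partial Ux _ => y _; exact: mean_curvatureE.
Qed.

Lemma nabla_pullback_mean_curvature i x : U x ->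
  nabla_pullback f a i (mean_curvature f a) x = m%:R^-1 *: partial i (tension f a) x.
Proof.
move=> Ux; rewrite /nabla_pullback partial_mean_curvature //.
by apply: tan_proj_id; rewrite dotZl (dot_dtension_map _ Ux) mulr0.
Qed.

(** Raising an index recovers a tangent vector from its scalar products with the frame. *)
Lemma tangent_components i (c : R) x : U x ->
  \sum_k \sum_l (inv_metric a x k l * (c * metric a x i k)) *: dmap f a l x =
  c *: dmap f a i x.
Proof.
move=> Ux; rewrite exchange_big /=.
have /matrixP E := mulmxV (metric_unit Ux).
transitivity (\sum_l (c * (i == l)%:R) *: dmap f a l x).
  apply: eq_bigr => l _; rewrite -scaler_suml; congr (_ *: _).
  have := E i l; rewrite !mxE => <-; rewrite mulr_sumr; apply: eq_bigr => k _.
  by rewrite mulrC mulrA.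
rewrite (bigD1 i) //= big1 ?addr0 ?eqxx ?mulr1 // => l li.
by rewrite eq_sym (negbTE li) mulr0 scale0r.
Qed.

(** PMC says that d tau has no normal part in the sphere; pseudo-umbilicity prescribes its
    tangential part, which is given by the shape operator. *)
Lemma pmc_pseudo_umbilicalP x (s := dot (tension f a x) (tension f a x)) :
  (0 < m)%N -> U x ->
  ((forall i, nabla_normal f a i (mean_curvature f a) x = 0) /\
   shape_operator f a (mean_curvature f a) x =
     (enorm (mean_curvature f a x) ^+ 2)%:M) <->
  forall i, partial i (tension f a) x = - (s / m%:R) *: dmap f a i x.
Proof.
move=> m_gt0 Ux; have m0 : (m%:R : R) != 0 by rewrite pnatr_eq0 -lt0n.
have sE : enorm (mean_curvature f a x) ^+ 2 = s / m%:R ^+ 2.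
  by rewrite enorm_sqr mean_curvatureE dotZl dotZr -/s; field.
have unscale (u v : 'rV[R]_d) (c : R) :
    m%:R^-1 *: u = c *: v -> u = (m%:R * c) *: v.
  by rewrite -scalerA => <-; rewrite scalerA mulfV // scale1r.
split=> [[pm pu] i|h].
  (* Multiplying by the metric undoes the [inv_metric] in the shape operator and leaves <B, H> =
     |H|^2 g, with |H|^2 = s / m^2. *)
  have B j k : dot (second_fundamental_form f a j k x) (mean_curvature f a x) =
      s / m%:R ^+ 2 * metric a x j k.
    have := congr1 (fun A => (A *m metric a x) j k) pu.
    rewrite /shape_operator mulmxKV ?metric_unit // mul_scalar_mx !mxE => ->.
    by rewrite sE.
  have T k : dot (m%:R^-1 *: partial i (tension f a) x) (dmap f a k x) =
      - (s / m%:R ^+ 2) * metric a x i k.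
    rewrite dotZl (dot_dtension_dmap _ _ Ux) mulNr -B mean_curvatureE.
    by rewrite mulrN -(dotZr m%:R^-1).
  have := pm i; rewrite /nabla_normal /normal_part nabla_pullback_mean_curvature //.
  under eq_bigr do under eq_bigr do rewrite T.
  rewrite tangent_components // => /eqP; rewrite subr_eq0 => /eqP.
  by move=> /unscale ->; congr (_ *: _); field.
have T i k : dot (partial i (tension f a) x) (dmap f a k x) =
    - (s / m%:R) * metric a x i k.
  by rewrite h dotZl dot_dmap.
split=> [i|].
  rewrite /nabla_normal /normal_part nabla_pullback_mean_curvature //.
  under eq_bigr do under eq_bigr do rewrite dotZl T [m%:R^-1 * _]mulrA.
  by rewrite tangent_components // h scalerA subrr.
rewrite /shape_operator; set A := \matrix_(i, j) _.
have -> : A = (s / m%:R ^+ 2) *: metric a x.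
  apply/matrixP => i j; rewrite !mxE mean_curvatureE dotZr.
  have := T i j; rewrite (dot_dtension_dmap _ _ Ux) mulNr => /oppr_inj ->.
  by field.
by rewrite sE -scalemxAl mulmxV ?metric_unit // scalemx1.
Qed.

(** Bochner-type identity: half the Laplacian of the constant |tau|^2 is 0 and equals <lap tau, tau>
    + |d tau|^2. *)
Lemma dot_laplacian_tension (c : R) x :
  (forall y, U y -> dot (tension f a y) (tension f a y) = c) -> U x ->
  dot (laplacian a (tension f a) x) (tension f a x) =
  - gtrace (inv_metric a x) (fun i j =>
    dot (partial i (tension f a) x) (partial j (tension f a) x) : R^o).
Proof.
move=> sc Ux.
have D k y : U y -> dot (partial k (tension f a) y) (tension f a y) = 0.
  move=> Uy; have := partial_dot_const Uy smooth_tension smooth_tension sc k.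
  rewrite [in RHS]dotC => /eqP.
  by rewrite -addr_eq0 -mulr2n mulrn_eq0 /= => /eqP.
have H i j : dot (partial i (partial j (tension f a)) x) (tension f a x) =
    -1 *: (dot (partial i (tension f a) x) (partial j (tension f a) x) : R^o).
  rewrite scaleN1r [in RHS]dotC.
  exact: (partial_dot_const Ux (smooth_partial _ smooth_tension) smooth_tension (D j)).
have E i j : dot (partial i (partial j (tension f a)) x -
      \sum_k christoffel a k i j x *: partial k (tension f a) x) (tension f a x) =
    -1 *: (dot (partial i (tension f a) x) (partial j (tension f a) x) : R^o).
  by apply: etrans (H i j); apply: dot_orth => k; exact: D.
by rewrite dot_gtrace (eq_gtrace _ E) gtraceZ scaleN1r.
Qed.

(** Projecting the second derivatives of tau to the sphere removes the component <B, tau> F, whose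
    trace is |tau|^2 F; the curvature term is m tau because tau is normal and the sphere has
    curvature 1. *)
Lemma bitensionE x : r = 1 -> U x ->
  bitension f a x = laplacian a (tension f a) x
    - dot (tension f a x) (tension f a x) *: F x + m%:R *: tension f a x.
Proof.
move=> r1 Ux; rewrite /bitension.
have F1 : dot (F x) (F x) = 1 by rewrite dot_map r1 expr1n.
have F0 : F x != 0 by rewrite -dot_eq0 F1 oner_eq0.
have N k y : U y -> nabla_pullback f a k (tension f a) y = partial k (tension f a) y.
  by move=> Uy; apply: tan_proj_id; exact: dot_dtension_map Uy.
have L i j : nabla_pullback f a i (nabla_pullback f a j (tension f a)) x
      - \sum_k christoffel a k i j x *: nabla_pullback f a k (tension f a) x =
    (partial i (partial j (tension f a)) x
      - \sum_k christoffel a k i j x *: partial k (tension f a) x)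
    - (dot (second_fundamental_form f a j i x) (tension f a x) : R^o) *: F x.
  rewrite [in RHS]addrAC; congr (_ - _); last first.
    by apply: eq_bigr => k _; rewrite (N _ _ Ux).
  rewrite {1}/nabla_pullback (eq_partial i Ux (N j)) /tan_proj F1 divr1.
  by rewrite (dot_hess_tension_map _ _ Ux).
have K i j : sphere_curvature (F x) (dmap f a i x) (tension f a x) (dmap f a j x) =
    -1 *: (metric a x i j *: tension f a x).
  rewrite (sphere_curvatureE F0 (dot_dmap_map _ Ux) (dot_tension_map Ux)
    (dot_dmap_map _ Ux)).
  rewrite (dot_tension_dmap _ Ux) (dot_dmap _ _ Ux) F1 !divr1 scale0r.
  by rewrite sub0r scaleN1r.
congr (_ + _).
  rewrite /rough_laplacian opprK -gtraceE (eq_gtrace _ L) gtraceB.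
  congr (_ - _); rewrite -tension_trace_r !gtraceE exchange_big /= scaler_suml.
  apply: eq_bigr => i _; rewrite scaler_suml; apply: eq_bigr => j _.
  by rewrite (inv_metric_sym _ _ Ux) scalerA.
rewrite -gtraceE (eq_gtrace _ K) gtraceZ gtrace_metric.
- by rewrite scaleN1r opprK.
- exact: metric_unit.
- exact: Defs.metric_sym.
Qed.

End Immersion.

(** * Local constancy, charts and connectedness *)

Section Constancy.
Variables (R : realType) (m d : nat) (M : riemannian R m).

Lemma derive_partial0 (V : 'rV[R]_m -> 'rV[R]_d) x h :
  differentiable V x -> (forall i, partial i V x = 0) -> 'D_h V x = 0.
Proof.
move=> dV V0; rewrite (row_sum_delta h) deriveE // linear_sum big1 // => i _.
by rewrite linearZ /= -deriveE // -/(partial i V x) V0 scaler0.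
Qed.

Lemma locally_constant (a : chart M) (V : 'rV[R]_m -> 'rV[R]_d) x :
  smooth_on (img a) V -> (forall y, img a y -> forall i, partial i V y = 0) ->
  img a x -> \forall y \near x, V y = V x.
Proof.
move=> sV V0 Ux.
have /nbhs_ballP[e /= e0 eU] := near_img Ux.
apply/nbhs_ballP; exists e => // y xy; apply/rowP => j.
apply: (@constant_of_derive0 _ _ (fun y => V y 0 j) x e) => // [z /eU Uz|z h /eU Uz].
  exact: smooth_differentiable (smooth_entry 0 j (@open_img _ _ M a) sV) Uz.
rewrite derive_entry; last exact: smooth_differentiable sV Uz.
rewrite derive_partial0 ?mxE //; last exact: V0.
exact: smooth_differentiable sV Uz.
Qed.

Lemma chartK (a : chart M) x : img a x -> chart_map a (param a x) = x.
Proof. by move=> [p ap <-]; rewrite chart_mapK. Qed.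

Lemma dom_param (a : chart M) x : img a x -> dom a (param a x).
Proof. by move=> [p ap <-]; rewrite chart_mapK. Qed.

Lemma img_chart (a : chart M) p : dom a p -> img a (chart_map a p).
Proof. by move=> ap; exists p. Qed.

(** The conclusion holds near [x] and not just at [x], so that the lemma can be iterated to second
    derivatives. *)
Lemma near_dot_partial0 (a : chart M) (V : 'rV[R]_m -> 'rV[R]_d) w K x :
  smooth_on (img a) V -> img a x -> (\forall y \near x, dot w (V y) = K) ->
  forall i, \forall y \near x, dot w (partial i V y) = 0.
Proof.
move=> sV Ux wV i.
apply: filterS2 (nbhs_interior wV) (near_img Ux) => y wy Uy.
transitivity ('D_(delta_mx 0 i) (fun z => dot w (V z)) y).
  rewrite (derive_dot (F := fun _ => w)).
  - by rewrite derive_cst dot0l add0r.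
  - exact: differentiable_cst.
  - exact: smooth_differentiable sV Uy.
by rewrite (near_eq_derive (g := fun _ => K)) ?derive_cst.
Qed.

(** Connectedness: the set [S] where some chart gives the value [v] is open by local constancy, and
    closed because moreover the charts agree on overlaps. *)
Lemma constant_of_charts (V : chart M -> 'rV[R]_m -> 'rV[R]_d) (p0 : M) :
  (forall a x, img a x -> \forall y \near x, V a y = V a x) ->
  (forall a b p, dom a p -> dom b p ->
    V a (chart_map a p) = V b (chart_map b p)) ->
  exists v, forall a x, img a x -> V a x = v.
Proof.
move=> Vloc Vab; have [a0 a0p] := dom_cover p0.
pose v := V a0 (chart_map a0 p0).
pose S : set M := [set p | exists2 a : chart M, dom a p & V a (chart_map a p) = v].
have near_chart a p : dom a p ->
    \forall q \near p, dom a q /\ V a (chart_map a q) = V a (chart_map a p).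
  move=> ap.
  have N1 : nbhs p (dom a) by apply: open_nbhs_nbhs; split => //; exact: dom_open.
  have N2 := chart_map_continuous ap (Vloc a _ (img_chart ap)).
  by apply: filterS2 N1 N2.
have oS : open S.
  rewrite openE => p [a ap Ev].
  by apply: filterS (near_chart a p ap) => q [aq E]; exists a; rewrite ?E.
have cS : closed S.
  rewrite -openC openE => p nSp; have [a ap] := dom_cover p.
  apply: filterS (near_chart a p ap) => q [aq E] [b bq Eb].
  by apply: nSp; exists a => //; rewrite -E (Vab a b).
have ST : S = [set: M].
  apply: (@points_connected _ _ M); first by exists p0, a0.
  - by exists S => //; rewrite setTI.
  - by exists S => //; rewrite setTI.
exists v => a x Ux.
have [b bp <-] : S (param a x) by rewrite ST.
by rewrite -(Vab a b) ?chartK //; exact: dom_param.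
Qed.

End Constancy.

(* Two values v, w of the vector at p, taken in different charts, have the same
   scalar product with f near p, hence with the Laplacian of f at p, hence with
   v and with w; so |v - w| = 0.  No change of variables in the Christoffel
   symbols is needed. *)
Lemma tension_shift_constant (R : realType) (m d : nat) (M : riemannian R m)
    (f : M -> 'rV[R]_d) (r c : R) (p0 : M) :
  0 < r -> isometric_immersion f r ->
  (forall (a : chart M) x, img a x ->
    forall i, partial i (tension f a) x = - c *: dmap f a i x) ->
  exists v, forall (a : chart M) x, img a x ->
    tension f a x + c *: local_map f a x = v.
Proof.
move=> r0 imm dT.
pose V (a : chart M) x := tension f a x + c *: local_map f a x.
have sT (a : chart M) := smooth_tension imm a.
have sF (a : chart M) := smooth_local_map imm a.
have scF (a : chart M) : smooth_on (img a) (fun x => c *: local_map f a x).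
  by apply: smooth_scale => //; [exact: open_img|exact: smooth_cst].
have sV (a : chart M) : smooth_on (img a) (V a).
  by apply: smoothD => //; exact: open_img.
have V0 (a : chart M) x : img a x -> forall i, partial i (V a) x = 0.
  move=> Ux i; rewrite (partialD i Ux (sT a) (scF a)) (partialZ i c Ux (sF a)).
  by rewrite dT // partial_local_map scaleNr addNr.
have Vloc (a : chart M) x : img a x -> \forall y \near x, V a y = V a x.
  by move=> Ux; exact: locally_constant (sV a) (V0 a) Ux.
have VF (a : chart M) x : img a x -> dot (V a x) (local_map f a x) = c * r ^+ 2.
  move=> Ux; rewrite dotDl (dot_tension_map r0 imm Ux) add0r dotZl.
  by rewrite (dot_map imm).
(* [C] is the value of <w, tau + c F>: expand tau as lap F + (m / r^2) F, where <w, lap F> = 0 since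
   <w, F> is locally constant. *)
pose C := (m%:R / r ^+ 2 + c) * (c * r ^+ 2).
have dotV (a : chart M) w x : img a x ->
    (\forall y \near x, dot w (local_map f a y) = c * r ^+ 2) ->
    dot w (V a x) = C.
  move=> Ux wF; have wF1 := near_dot_partial0 (sF a) Ux wF.
  have wF2 i j := near_dot_partial0 (smooth_partial j (sF a)) Ux (wF1 j) i.
  have wL : dot w (laplacian a (local_map f a) x) = 0.
    rewrite dotC dot_gtrace gtrace0 // => i j.
    apply: etrans (dot_orth _ _ _) _ => [k|].
      by rewrite dotC; exact: nbhs_singleton (wF1 k).
    by rewrite dotC; exact: nbhs_singleton (wF2 i j).
  rewrite /V (tensionE imm Ux) !dotDr wL add0r !dotZr -mulrDl.
  by rewrite (nbhs_singleton wF).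
apply: (constant_of_charts p0 Vloc) => a b p ap bp.
(* Near [p] the vector read in the chart [g] does not vary, so its product with [f] may be computed
   at each nearby point, where it is c r^2. *)
have near_const (e g : chart M) : dom e p -> dom g p ->
    \forall z \near chart_map e p,
      dot (V g (chart_map g p)) (local_map f e z) = c * r ^+ 2.
  move=> ep gp.
  have N1 := near_img (img_chart ep).
  have Ng : \forall q \near p, dom g q /\
      V g (chart_map g q) = V g (chart_map g p).
    have N2 : nbhs p (dom g) by apply: open_nbhs_nbhs; split => //; exact: dom_open.
    have N3 := chart_map_continuous gp (Vloc g _ (img_chart gp)).
    by apply: filterS2 N2 N3.
  have N4 : \forall z \near chart_map e p, dom g (param e z) /\
      V g (chart_map g (param e z)) = V g (chart_map g p).
    have := param_continuous ep.
    by rewrite /prop_for /continuous_at (chart_mapK ep) => cv; exact: (cv _ Ng).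
  apply: filterS2 N1 N4 => z Uz [gz <-].
  rewrite -(VF g _ (img_chart gz)); congr dot.
  by rewrite /local_map /= chart_mapK.
have Eaa := dotV a _ _ (img_chart ap) (near_const a a ap ap).
have Eba := dotV a _ _ (img_chart ap) (near_const a b ap bp).
have Ebb := dotV b _ _ (img_chart bp) (near_const b b bp bp).
apply/eqP; rewrite -subr_eq0 -dot_eq0 dotBl !dotBr Eaa Eba Ebb dotC Eba.
by rewrite !subrr.
Qed.
(** * Riemannian products *)

Section Product.
Variables (R : realType) (m1 m2 : nat) (M1 : riemannian R m1) (M2 : riemannian R m2).

Lemma lsub_delta_lshift (i : 'I_m1) :
  lsubmx (delta_mx 0 (lshift m2 i) : 'rV[R]_(m1 + m2)) = delta_mx 0 i.
Proof. by apply/rowP => j; rewrite !mxE eq_lshift. Qed.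

Lemma rsub_delta_lshift (i : 'I_m1) :
  rsubmx (delta_mx 0 (lshift m2 i) : 'rV[R]_(m1 + m2)) = 0.
Proof. by apply/rowP => j; rewrite !mxE eq_rlshift. Qed.

Lemma lsub_delta_rshift (i : 'I_m2) :
  lsubmx (delta_mx 0 (rshift m1 i) : 'rV[R]_(m1 + m2)) = 0.
Proof. by apply/rowP => j; rewrite !mxE eq_lrshift. Qed.

Lemma rsub_delta_rshift (i : 'I_m2) :
  rsubmx (delta_mx 0 (rshift m1 i) : 'rV[R]_(m1 + m2)) = delta_mx 0 i.
Proof. by apply/rowP => j; rewrite !mxE eq_rshift. Qed.

Section Fields.
Variables (d1 d2 : nat) (c : chart (prod_riemannian M1 M2)).
Variables (V1 : 'rV[R]_m1 -> 'rV[R]_d1) (V2 : 'rV[R]_m2 -> 'rV[R]_d2).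
Hypotheses (s1 : smooth_on (img c.1) V1) (s2 : smooth_on (img c.2) V2).
Let W (x : 'rV[R]_(m1 + m2)) : 'rV[R]_(d1 + d2) :=
  row_mx (V1 (lsubmx x)) (V2 (rsubmx x)).

Lemma img_prod x : img c x -> img c.1 (lsubmx x) /\ img c.2 (rsubmx x).
Proof. by rewrite (@prod_img R m1 m2 M1 M2 c). Qed.

Lemma derive_row_mx x h : img c x ->
  'D_h W x = row_mx ('D_(lsubmx h) V1 (lsubmx x)) ('D_(rsubmx h) V2 (rsubmx x)).
Proof.
move=> /img_prod[i1 i2].
have d1V := smooth_differentiable s1 i1; have d2V := smooth_differentiable s2 i2.
have dW : differentiable W x.
  have o : open (img c) by exact: open_img.
  have := smooth_row_mx _ s1 s2.
  rewrite -[X in open X -> _](@prod_img R m1 m2 M1 M2 c) => /(_ o) sW.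
  by apply: smooth_differentiable sW _; split.
rewrite (deriveEjacobian _ dW) jacobian_row_mx //.
rewrite -{1}[h]hsubmxK mul_row_block !mulmx0 addr0 add0r.
by rewrite !deriveEjacobian.
Qed.

End Fields.

Lemma partial_row_mx d1 d2 (c : chart (prod_riemannian M1 M2))
    (V1 : 'rV[R]_m1 -> 'rV[R]_d1) (V2 : 'rV[R]_m2 -> 'rV[R]_d2)
    (W := fun x : 'rV[R]_(m1 + m2) => row_mx (V1 (lsubmx x)) (V2 (rsubmx x))) x :
  smooth_on (img c.1) V1 -> smooth_on (img c.2) V2 -> img c x ->
  (forall i, partial (lshift m2 i) W x = row_mx (partial i V1 (lsubmx x)) 0) /\
  (forall i, partial (rshift m1 i) W x = row_mx 0 (partial i V2 (rsubmx x))).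
Proof.
move=> s1 s2 Ux; split=> i; rewrite /partial (derive_row_mx s1 s2 _ Ux).
- by rewrite lsub_delta_lshift rsub_delta_lshift derive0.
- by rewrite lsub_delta_rshift rsub_delta_rshift derive0.
Qed.

Lemma partial2_row_mx d1 d2 (c : chart (prod_riemannian M1 M2))
    (V1 : 'rV[R]_m1 -> 'rV[R]_d1) (V2 : 'rV[R]_m2 -> 'rV[R]_d2)
    (W := fun x : 'rV[R]_(m1 + m2) => row_mx (V1 (lsubmx x)) (V2 (rsubmx x))) x :
  smooth_on (img c.1) V1 -> smooth_on (img c.2) V2 -> img c x ->
  (forall i j, partial (lshift m2 i) (partial (lshift m2 j) W) x =
     row_mx (partial i (partial j V1) (lsubmx x)) 0) /\
  (forall i j, partial (rshift m1 i) (partial (rshift m1 j) W) x =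
     row_mx 0 (partial i (partial j V2) (rsubmx x))).
Proof.
move=> s1 s2 Ux.
(* A zero field in the missing slot lets [partial_row_mx] apply a second time. *)
have z1 : smooth_on (img c.1) (fun _ : 'rV[R]_m1 => 0 : 'rV[R]_d1) by exact: smooth_cst.
have z2 : smooth_on (img c.2) (fun _ : 'rV[R]_m2 => 0 : 'rV[R]_d2) by exact: smooth_cst.
split=> i j.
- have E y : img c y -> partial (lshift m2 j) W y =
      row_mx (partial j V1 (lsubmx y)) ((fun _ => 0) (rsubmx y)).
    by move=> Uy; have [-> _] := partial_row_mx s1 s2 Uy.
  rewrite (eq_partial _ Ux E).
  by have [-> _] := partial_row_mx (smooth_partial j s1) z2 Ux.
- have E y : img c y -> partial (rshift m1 j) W y =
      row_mx ((fun _ => 0) (lsubmx y)) (partial j V2 (rsubmx y)).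
    by move=> Uy; have [_ ->] := partial_row_mx s1 s2 Uy.
  rewrite (eq_partial _ Ux E).
  by have [_ ->] := partial_row_mx z1 (smooth_partial j s2) Ux.
Qed.

Section Chart.
Variables (c : chart (prod_riemannian M1 M2)) (x : 'rV[R]_(m1 + m2)).
Hypothesis Ux : img c x.
Let x1 := lsubmx x.
Let x2 := rsubmx x.
Let ix1 : img c.1 x1. Proof. by case: (img_prod Ux). Qed.
Let ix2 : img c.2 x2. Proof. by case: (img_prod Ux). Qed.

Lemma inv_metric_prod :
  inv_metric c x = block_mx (inv_metric c.1 x1) 0 0 (inv_metric c.2 x2).
Proof. by apply: invmx_block_diag; exact: (@metric_unit R _ _ _ x Ux). Qed.

Lemma dmetric_prod_entry p i j : dmetric c p x i j =
  'D_(delta_mx 0 p) (fun y => metric c y i j) x.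
Proof.
rewrite derive_entry //.
exact: smooth_differentiable (@metric_smooth _ _ (prod_riemannian M1 M2) c) Ux.
Qed.

Lemma derive_lsub (f : 'rV[R]_m1 -> R) (h : 'rV[R]_(m1 + m2)) :
  'D_h (fun y : 'rV[R]_(m1 + m2) => f (lsubmx y)) x = 'D_(lsubmx h) f x1.
Proof. exact: (@derive_linr _ _ _ _ _ _ lsubmx). Qed.

Lemma derive_rsub (f : 'rV[R]_m2 -> R) (h : 'rV[R]_(m1 + m2)) :
  'D_h (fun y : 'rV[R]_(m1 + m2) => f (rsubmx y)) x = 'D_(rsubmx h) f x2.
Proof. exact: (@derive_linr _ _ _ _ _ _ rsubmx). Qed.

Lemma dmetric_prod_ll p i j :
  dmetric c p x (lshift m2 i) (lshift m2 j) =
  'D_(lsubmx (delta_mx 0 p)) (fun y => metric c.1 y i j) x1.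
Proof.
rewrite dmetric_prod_entry -derive_lsub.
by under eq_fun do rewrite /= /prod_metric block_mxEul.
Qed.

Lemma dmetric_prod_rr p i j :
  dmetric c p x (rshift m1 i) (rshift m1 j) =
  'D_(rsubmx (delta_mx 0 p)) (fun y => metric c.2 y i j) x2.
Proof.
rewrite dmetric_prod_entry -derive_rsub.
by under eq_fun do rewrite /= /prod_metric block_mxEdr.
Qed.

Lemma dmetric_prod_lr p i j : dmetric c p x (lshift m2 i) (rshift m1 j) = 0.
Proof.
rewrite dmetric_prod_entry.
by under eq_fun do rewrite /= /prod_metric block_mxEur mxE; exact: derive_cst.
Qed.

Lemma dmetric_prod_rl p i j : dmetric c p x (rshift m1 i) (lshift m2 j) = 0.
Proof.
rewrite dmetric_prod_entry.
by under eq_fun do rewrite /= /prod_metric block_mxEdl mxE; exact: derive_cst.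
Qed.

Lemma dmetric_l l i j : dmetric c (lshift m2 l) x (lshift m2 i) (lshift m2 j) =
  dmetric c.1 l x1 i j.
Proof.
rewrite dmetric_prod_ll lsub_delta_lshift derive_entry //.
exact: smooth_differentiable (@metric_smooth _ _ M1 c.1) ix1.
Qed.

Lemma dmetric_r l i j : dmetric c (rshift m1 l) x (rshift m1 i) (rshift m1 j) =
  dmetric c.2 l x2 i j.
Proof.
rewrite dmetric_prod_rr rsub_delta_rshift derive_entry //.
exact: smooth_differentiable (@metric_smooth _ _ M2 c.2) ix2.
Qed.

Lemma eq_koszul (g a b c' a' b' c'' : R) :
  a = a' -> b = b' -> c' = c'' -> g * (a + b - c') = g * (a' + b' - c'').
Proof. by move=> -> -> ->. Qed.

Lemma christoffel_lll k i j :
  christoffel c (lshift m2 k) (lshift m2 i) (lshift m2 j) x =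
  christoffel c.1 k i j x1.
Proof.
rewrite /christoffel big_split_ord /= inv_metric_prod; congr (_ * _).
rewrite [X in _ + X]big1 ?addr0; last first.
  by move=> l _; rewrite block_mxEur mxE mul0r.
apply: eq_bigr => l _; rewrite block_mxEul.
exact: eq_koszul (dmetric_l i j l) (dmetric_l j i l) (dmetric_l l i j).
Qed.

Lemma christoffel_rrr k i j :
  christoffel c (rshift m1 k) (rshift m1 i) (rshift m1 j) x =
  christoffel c.2 k i j x2.
Proof.
rewrite /christoffel big_split_ord /= inv_metric_prod; congr (_ * _).
rewrite big1 ?add0r; last by move=> l _; rewrite block_mxEdl mxE mul0r.
apply: eq_bigr => l _; rewrite block_mxEdr.
exact: eq_koszul (dmetric_r i j l) (dmetric_r j i l) (dmetric_r l i j).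
Qed.

(** The inverse metric has no mixed entries, the metric has none either, and its block for the first
    factor does not depend on the second variables. *)
Lemma christoffel_rll k i j :
  christoffel c (rshift m1 k) (lshift m2 i) (lshift m2 j) x = 0.
Proof.
rewrite /christoffel big_split_ord /= inv_metric_prod !big1 ?addr0 ?mulr0 //.
- move=> l _; apply: etrans (eq_koszul _ (dmetric_prod_lr _ _ _)
    (dmetric_prod_lr _ _ _) (dmetric_prod_ll _ _ _)) _.
  by rewrite lsub_delta_rshift derive0 !addr0 subrr mulr0.
- by move=> l _; rewrite block_mxEdl mxE mul0r.
Qed.

Lemma christoffel_lrr k i j :
  christoffel c (lshift m2 k) (rshift m1 i) (rshift m1 j) x = 0.
Proof.
rewrite /christoffel big_split_ord /= inv_metric_prod !big1 ?addr0 ?mulr0 //.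
- by move=> l _; rewrite block_mxEur mxE mul0r.
- move=> l _; apply: etrans (eq_koszul _ (dmetric_prod_rl _ _ _)
    (dmetric_prod_rl _ _ _) (dmetric_prod_rr _ _ _)) _.
  by rewrite rsub_delta_lshift derive0 !addr0 subrr mulr0.
Qed.

#[local] Opaque christoffel partial.

(** The inverse metric is block diagonal, so only second derivatives and Christoffel symbols with
    both lower indices in one factor enter. *)
Lemma laplacian_prod d1 d2 (V1 : 'rV[R]_m1 -> 'rV[R]_d1)
    (V2 : 'rV[R]_m2 -> 'rV[R]_d2) :
  smooth_on (img c.1) V1 -> smooth_on (img c.2) V2 ->
  laplacian c (fun y : 'rV[R]_(m1 + m2) => row_mx (V1 (lsubmx y)) (V2 (rsubmx y))) x =
  row_mx (laplacian c.1 V1 x1) (laplacian c.2 V2 x2).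
Proof.
move=> s1 s2.
have [p1 p2] := partial_row_mx s1 s2 Ux; have [q1 q2] := partial2_row_mx s1 s2 Ux.
rewrite /laplacian !gtraceE big_split_ord /= inv_metric_prod.
have -> (u : 'rV[R]_d1) (v : 'rV[R]_d2) : row_mx u v = row_mx u 0 + row_mx 0 v.
  by rewrite add_row_mx addr0 add0r.
have [Ll LlE] : exists L : {linear 'rV[R]_d1 -> 'rV[R]_(d1 + d2)},
    forall u, row_mx u 0 = L u.
  by exists (mulmxr (row_mx 1%:M 0)) => u /=; rewrite mul_mx_row mulmx1 mulmx0.
have [Lr LrE] : exists L : {linear 'rV[R]_d2 -> 'rV[R]_(d1 + d2)},
    forall u, row_mx 0 u = L u.
  by exists (mulmxr (row_mx 0 1%:M)) => u /=; rewrite mul_mx_row mulmx1 mulmx0.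
congr (_ + _).
- rewrite LlE linear_sum; apply: eq_bigr => i _; rewrite linear_sum.
  rewrite big_split_ord /= [X in _ + X]big1 ?addr0; last first.
    by move=> j _; rewrite block_mxEur mxE scale0r.
  apply: eq_bigr => j _; rewrite block_mxEul q1 LlE; apply: etrans (esym (linearZ _ _)).
  congr (_ *: _); rewrite (raddfB Ll) (raddf_sum Ll); congr (_ - _).
  rewrite big_split_ord /= [X in _ + X]big1 ?addr0; last first.
    by move=> k _; rewrite christoffel_rll scale0r.
  by apply: eq_bigr => k _; rewrite christoffel_lll p1 LlE linearZ.
- rewrite LrE linear_sum; apply: eq_bigr => i _; rewrite linear_sum.
  rewrite big_split_ord /= big1 ?add0r; last first.
    by move=> j _; rewrite block_mxEdl mxE scale0r.
  apply: eq_bigr => j _; rewrite block_mxEdr q2 LrE; apply: etrans (esym (linearZ _ _)).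
  congr (_ *: _); rewrite (raddfB Lr) (raddf_sum Lr); congr (_ - _).
  rewrite big_split_ord /= big1 ?add0r; last first.
    by move=> k _; rewrite christoffel_lrr scale0r.
  by apply: eq_bigr => k _; rewrite christoffel_rrr p2 LrE linearZ.
Qed.

End Chart.
End Product.

(** * Orthonormal bases of hyperplanes *)

Section Householder.
Variable R : realType.

(** The reflection along [o - e] exchanges [e] with the first basis vector [o]; its matrix is
    symmetric and has first row [e]. *)
Lemma householder n (e : 'rV[R]_(1 + n)) : dot e e = 1 ->
  exists P : 'M[R]_(1 + n), P *m P^T = 1%:M /\ usubmx P = e.
Proof.
move=> ee; pose o : 'rV[R]_(1 + n) := delta_mx 0 (lshift n 0).
have uE (P : 'M[R]_(1 + n)) : usubmx P = o *m P.
  by rewrite /o -rowE; apply/matrixP => i j; rewrite !mxE ord1.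
have oo : dot o o = 1.
  rewrite dotE (bigD1 (lshift n 0)) //= big1 ?addr0 ?mxE ?eqxx ?mul1r // => j /negbTE.
  by rewrite mxE eqxx /= => ->; rewrite mul0r.
have [u Eu] : exists u, u = o - e by exists (o - e).
have [u0|u_neq0] := eqVneq u 0.
  exists 1%:M; rewrite trmx1 mulmx1 uE mulmx1; split=> //.
  by apply/eqP; rewrite -subr_eq0 -Eu u0.
have uu0 : dot u u != 0 by rewrite dot_eq0.
pose k := 2 / dot u u; exists (1%:M - k *: (u^T *m u)).
split.
  have -> : (1%:M - k *: (u^T *m u))^T = 1%:M - k *: (u^T *m u).
    apply/matrixP => i j; rewrite !mxE !big_ord1 !mxE eq_sym.
    by congr (_ - _ * _); rewrite mulrC.
  rewrite mulmxBl mul1mx mulmxBr mulmx1.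
  rewrite -scalemxAl -scalemxAr mulmxA -(mulmxA u^T u) mulmx_tr mul_mx_scalar.
  rewrite -scalemxAl !scalerA -scalerBl -addrA -opprD -scalerDl.
  set z := (X in X *: _); suff -> : z = 0 by rewrite scale0r subr0.
  by rewrite /z /k; field.
rewrite uE mulmxBr mulmx1 -scalemxAr mulmxA mulmx_tr mul_scalar_mx scalerA.
(* As [o] and [e] are unit vectors, |o - e|^2 = 2 <o, o - e>, so the reflection subtracts exactly
   [u] from [o]. *)
have -> : k * dot o u = 1.
  have E : dot u u = 2 * dot o u.
    by rewrite Eu dotBl !dotBr oo ee (dotC e o); ring.
  by rewrite /k E; field; move: uu0; rewrite E; apply: contra_neq => ->; rewrite mulr0.
by rewrite scale1r Eu opprB addrC subrK.
Qed.

(** Complete the normalized [w] to an orthogonal matrix; its rows after the first span the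
    hyperplane orthogonal to [w]. *)
Lemma hyperplane_basis n (w : 'rV[R]_n.+1) : w != 0 ->
  exists Q : 'M[R]_(n, n.+1), [/\ Q *m Q^T = 1%:M, w *m Q^T = 0
    & forall u, dot u w = 0 -> u *m Q^T *m Q = u].
Proof.
move=> w0; have ww : 0 < dot w w by rewrite lt_def dot_eq0 w0 dot_ge0.
have nw0 : enorm w != 0 by rewrite gt_eqF // sqrtr_gt0.
pose e : 'rV[R]_(1 + n) := (enorm w)^-1 *: w.
have [|P [PP Pe]] := @householder n e.
  by rewrite dotZl dotZr -enorm_sqr; field.
have wE : w = enorm w *: e by rewrite scalerA divff // scale1r.
pose Q : 'M[R]_(n, n.+1) := dsubmx P; exists Q.
have PE : P = col_mx e Q by rewrite -Pe vsubmxK.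
have := PP; rewrite {1 2}PE tr_col_mx mul_col_row.
rewrite (@scalar_mx_block _ 1 n 1) => /eq_block_mx[_ eQ _ QQ].
split=> // [|u uw]; first by rewrite wE -scalemxAl eQ scaler0.
have := mulmx1C PP; rewrite PE tr_col_mx mul_row_col => /(congr1 (mulmx u)).
rewrite mulmxDr mulmx1 mulmxA.
have -> : u *m e^T = 0.
  by rewrite mulmx_tr dotZr uw mulr0 raddf0.
by rewrite mul0mx add0r mulmxA.
Qed.

End Householder.

(** * Rigidity of a single factor *)

Section Factor.
Variables (R : realType) (m d : nat) (M : riemannian R m) (f : M -> 'rV[R]_d).

(** For [m = 0] the factor 1/m in the mean curvature is 0 by convention, so the immersion would be
    minimal. *)
Lemma nonminimal_gt0 : ~ minimal f -> (0 < m)%N.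
Proof.
rewrite lt0n => nmin; apply/eqP => m0; apply: nmin => a x _.
have -> : mean_curvature f a x = 0 *: tension f a x.
  by rewrite mean_curvatureE; congr (_ *: _); rewrite m0 invr0.
by rewrite scale0r.
Qed.

Lemma nonminimal_point : ~ minimal f ->
  exists (a : chart M) (x : 'rV[R]_m), img a x /\ tension f a x != 0.
Proof.
move=> nmin; apply/not_existsP => h; apply: nmin => a x Ux.
have [T0|T0] := eqVneq (tension f a x) 0.
  by rewrite mean_curvatureE T0 scaler0.
by case: (h a); exists x.
Qed.

(** The Jacobian times its transpose is the metric, which is invertible; so preserving the metric
    already forces an immersion. *)
Lemma row_free_gram (a : chart M) x :
  smooth_on (img a) (local_map f a) -> img a x ->
  (forall i j, dot (dmap f a i x) (dmap f a j x) = metric a x i j) ->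
  row_free ('J (local_map f a) x).
Proof.
move=> sF Ux gram; apply/row_freeP.
have E i : row i ('J (local_map f a) x) = dmap f a i x.
  rewrite rowE -deriveEjacobian //; exact: smooth_differentiable sF Ux.
have JJ : 'J (local_map f a) x *m ('J (local_map f a) x)^T = metric a x.
  apply/matrixP => i j; rewrite -gram -!E dotE mxE.
  by apply: eq_bigr => k _; rewrite !mxE.
exists (('J (local_map f a) x)^T *m invmx (metric a x)).
by rewrite mulmxA JJ mulmxV // metric_unit.
Qed.

End Factor.

(* With [mu] the dimension of the product and [c = mu - m / r^2], the tension of
   the product has first component [tension f + c f]; the hypothesis is the
   corresponding component of the biharmonic equation. *)
Lemma factor_rigidity (R : realType) (m d : nat) (M : riemannian R m)
    (f : M -> 'rV[R]_d) (r mu S s : R) (c := mu - m%:R / r ^+ 2) (k := mu + c) :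
  0 < r -> isometric_immersion f r -> (0 < m)%N -> s != 0 ->
  (exists (a : chart M) x, img a x) ->
  (forall (a : chart M) x, img a x -> dot (tension f a x) (tension f a x) = s) ->
  (forall (a : chart M) x, img a x -> laplacian a (tension f a) x =
     (S - c ^+ 2) *: local_map f a x - k *: tension f a x) ->
  [/\ S = mu ^+ 2 <-> pmc f /\ pseudo_umbilical f
    & S = mu ^+ 2 -> s = m%:R * k /\ forall (a : chart M) x, img a x ->
        forall i, partial i (tension f a) x = - k *: dmap f a i x].
Proof.
move=> r0 imm m_gt0 s0 [a0 [x0 Ux0]] sE L.
have mn0 : (m%:R : R) != 0 by rewrite pnatr_eq0 -lt0n.
have rn0 : r != 0 by rewrite gt_eqF.
have sS : s = (S - c ^+ 2) * r ^+ 2.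
  rewrite -(sE a0 x0 Ux0) -(dot_laplacian_tension_map r0 imm Ux0) L //.
  by rewrite dotBl 2!dotZl (dot_map imm) (dot_tension_map r0 imm Ux0) mulr0 subr0.
have gram a x : img a x -> gtrace (inv_metric a x) (fun i j =>
    dot (partial i (tension f a) x) (partial j (tension f a) x) : R^o) = k * s.
  move=> Ux; have := dot_laplacian_tension imm (sE a) Ux.
  rewrite L // dotBl 2!dotZl (dotC (local_map f a x)).
  by rewrite (dot_tension_map r0 imm Ux) mulr0 sub0r sE // => /oppr_inj <-.
have mE : m%:R = r ^+ 2 * (mu - c) by rewrite /c; field.
(* Since m = r^2 (mu - c) and k = mu + c, one has s - m k = r^2 (S - mu^2). *)
have SE : (S = mu ^+ 2) <-> (s = m%:R * k).
  rewrite sS mE /k; split=> [->|]; first by ring.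
  move=> E; apply: (mulIf (_ : r ^+ 2 != 0)); first by rewrite expf_neq0.
  by rewrite -[S](subrK (c ^+ 2)) mulrDl E; ring.
(* The right-hand side is the equality case of Cauchy-Schwarz, as |d tau|^2 = k s; the factor [s]
   cancels because it is nonzero. *)
have gE : (s = m%:R * k) <-> (k * s = s ^+ 2 / m%:R).
  split=> [->|E]; first by field.
  apply: (mulIf s0); rewrite -mulrA E; by field.
have H a x : img a x -> (S = mu ^+ 2) <->
    ((forall i, nabla_normal f a i (mean_curvature f a) x = 0) /\
     shape_operator f a (mean_curvature f a) x =
       (enorm (mean_curvature f a x) ^+ 2)%:M).
  move=> Ux; have P := pmc_pseudo_umbilicalP r0 imm m_gt0 Ux.
  have Q := gram_dtension_eq r0 imm Ux.
  move: Q P; rewrite /= (sE a x Ux) (gram a x Ux) => Q P.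
  by rewrite SE gE Q P.
split.
  split=> [E|[pm pu]].
    by split=> a x Ux; have [pm pu] := (H a x Ux).1 E.
  by apply/(H a0 x0 Ux0); split; [exact: pm|exact: pu].
move=> /SE E; split=> // a x Ux i.
have := gram_dtension_eq r0 imm Ux.
rewrite /= (sE a x Ux) (gram a x Ux) => -[/(_ (gE.1 E)) -> _].
by rewrite E mulrAC divff // mul1r.
Qed.

(** * Tension and bitension of the product immersion *)

Section ProductImmersion.
Variables (R : realType) (m1 m2 d1 d2 : nat).
Variables (M1 : riemannian R m1) (M2 : riemannian R m2).
Variables (f1 : M1 -> 'rV[R]_d1) (f2 : M2 -> 'rV[R]_d2) (r1 r2 : R).
Variables (r1_gt0 : 0 < r1) (r2_gt0 : 0 < r2) (r12 : r1 ^+ 2 + r2 ^+ 2 = 1).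
Variables (imm1 : isometric_immersion f1 r1) (imm2 : isometric_immersion f2 r2).

Let f := prod_immersion f1 f2.
Let mu : R := (m1 + m2)%:R.
Let c1 := mu - m1%:R / r1 ^+ 2.
Let c2 := mu - m2%:R / r2 ^+ 2.

Lemma local_map_prod (c : chart (prod_riemannian M1 M2)) x :
  local_map f c x = row_mx (local_map f1 c.1 (lsubmx x)) (local_map f2 c.2 (rsubmx x)).
Proof. by []. Qed.

Lemma smooth_prod_map (c : chart (prod_riemannian M1 M2)) :
  smooth_on (img c) (local_map f c).
Proof.
have o : open (img c) by exact: open_img.
move: o; rewrite (@prod_img R m1 m2 M1 M2 c) => o.
exact: (smooth_row_mx o (smooth_local_map imm1 c.1) (smooth_local_map imm2 c.2)).
Qed.

Lemma gram_prod (c : chart (prod_riemannian M1 M2)) x : img c x ->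
  forall i j, dot (dmap f c i x) (dmap f c j x) = metric c x i j.
Proof.
move=> Ux; have [ix1 ix2] := img_prod Ux.
have [E1 E2] := partial_row_mx (smooth_local_map imm1 c.1)
  (smooth_local_map imm2 c.2) Ux.
have D1 i : dmap f c (lshift m2 i) x = row_mx (dmap f1 c.1 i (lsubmx x)) 0 by exact: E1.
have D2 i : dmap f c (rshift m1 i) x = row_mx 0 (dmap f2 c.2 i (rsubmx x)) by exact: E2.
move=> i j; rewrite -[metric c x]/(block_mx (metric c.1 (lsubmx x)) 0 0 (metric c.2 (rsubmx x))).
case: (split_ordP i) => [i' ->|i' ->]; case: (split_ordP j) => [j' ->|j' ->];
  rewrite ?D1 ?D2 dot_row_mx ?dot0l ?dot0r ?addr0 ?add0r.
- by rewrite block_mxEul (dot_dmap imm1).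
- by rewrite block_mxEur mxE.
- by rewrite block_mxEdl mxE.
- by rewrite block_mxEdr (dot_dmap imm2).
Qed.

Lemma prod_isometric : isometric_immersion f 1.
Proof.
split=> [[p q]|c].
  have [s1 _] := imm1; have [s2 _] := imm2.
  rewrite /sphere /= /enorm /f /prod_immersion dot_row_mx -!enorm_sqr /=.
  by have := s1 p; rewrite /sphere /= => ->; have := s2 q; rewrite /sphere /= => ->;
    rewrite r12 sqrtr1.
split=> [|x Ux]; first exact: smooth_prod_map.
split; last exact: gram_prod.
by apply: row_free_gram => //; [exact: smooth_prod_map|exact: gram_prod].
Qed.

Lemma tension_prod (c : chart (prod_riemannian M1 M2)) x : img c x ->
  tension f c x =
  row_mx (tension f1 c.1 (lsubmx x) + c1 *: local_map f1 c.1 (lsubmx x))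
         (tension f2 c.2 (rsubmx x) + c2 *: local_map f2 c.2 (rsubmx x)).
Proof.
move=> Ux; have [ix1 ix2] := img_prod Ux.
rewrite (tensionE prod_isometric Ux) expr1n divr1.
rewrite -[local_map f c]/(fun y : 'rV[R]_(m1 + m2) =>
  row_mx (local_map f1 c.1 (lsubmx y)) (local_map f2 c.2 (rsubmx y))).
rewrite (laplacian_prod Ux (smooth_local_map imm1 _) (smooth_local_map imm2 _)).
rewrite (tensionE imm1 ix1) (tensionE imm2 ix2) scale_row_mx add_row_mx.
(* Splits mu as k + (mu - k); with k = m_i / r_i^2 the first part is absorbed into the tension of
   the factor and the second is c_i. *)
have E d (l u : 'rV[R]_d) k : l + mu *: u = l + k *: u + (mu - k) *: u.
  by rewrite -addrA -scalerDl [k + _]addrC subrK.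
by rewrite (E d1 _ _ (m1%:R / r1 ^+ 2)) (E d2 _ _ (m2%:R / r2 ^+ 2)).
Qed.

Lemma dot_tension_prod (c : chart (prod_riemannian M1 M2)) x : img c x ->
  dot (tension f c x) (tension f c x) =
  dot (tension f1 c.1 (lsubmx x)) (tension f1 c.1 (lsubmx x)) +
  dot (tension f2 c.2 (rsubmx x)) (tension f2 c.2 (rsubmx x)) +
  (c1 ^+ 2 * r1 ^+ 2 + c2 ^+ 2 * r2 ^+ 2).
Proof.
move=> Ux; have [ix1 ix2] := img_prod Ux.
have E d (t u : 'rV[R]_d) c' : dot t u = 0 ->
    dot (t + c' *: u) (t + c' *: u) = dot t t + c' ^+ 2 * dot u u.
  by move=> tu; rewrite dotDl !dotDr !dotZl !dotZr (dotC u t) tu; ring.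
rewrite tension_prod // dot_row_mx.
rewrite (E _ _ _ c1 (dot_tension_map r1_gt0 imm1 ix1)).
rewrite (E _ _ _ c2 (dot_tension_map r2_gt0 imm2 ix2)).
by rewrite (dot_map imm1) (dot_map imm2) addrACA.
Qed.

Lemma biharmonic_components (c : chart (prod_riemannian M1 M2)) x
    (S := dot (tension f c x) (tension f c x)) :
  biharmonic f -> img c x ->
  laplacian c.1 (tension f1 c.1) (lsubmx x) =
    (S - c1 ^+ 2) *: local_map f1 c.1 (lsubmx x)
    - (mu + c1) *: tension f1 c.1 (lsubmx x) /\
  laplacian c.2 (tension f2 c.2) (rsubmx x) =
    (S - c2 ^+ 2) *: local_map f2 c.2 (rsubmx x)
    - (mu + c2) *: tension f2 c.2 (rsubmx x).
Proof.
move=> bih Ux; have [ix1 ix2] := img_prod Ux.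
have sT1 := smooth_tension imm1 c.1; have sT2 := smooth_tension imm2 c.2.
have sF1 := smooth_local_map imm1 c.1; have sF2 := smooth_local_map imm2 c.2.
have scale_smooth m d (M : riemannian R m) (a : chart M) k (V : 'rV[R]_m -> 'rV[R]_d) :
    smooth_on (img a) V -> smooth_on (img a) (fun y => k *: V y).
  by move=> sV; apply: smooth_scale => //; [exact: open_img|exact: smooth_cst].
have sV1 : smooth_on (img c.1) (fun y => tension f1 c.1 y + c1 *: local_map f1 c.1 y).
  by apply: smoothD => //; [exact: open_img|exact: scale_smooth].
have sV2 : smooth_on (img c.2) (fun y => tension f2 c.2 y + c2 *: local_map f2 c.2 y).
  by apply: smoothD => //; [exact: open_img|exact: scale_smooth].
have := bih c x Ux; rewrite (bitensionE ltr01 prod_isometric erefl Ux) -/S.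
rewrite (eq_laplacian Ux (@tension_prod c)) (laplacian_prod Ux sV1 sV2).
rewrite (laplacian_lin c1 ix1 sT1 sF1) (laplacian_lin c2 ix2 sT2 sF2).
rewrite tension_prod // local_map_prod !scale_row_mx opp_row_mx !add_row_mx.
have shift d (l u : 'rV[R]_d) k : l = l + k *: u - (mu - (mu - k)) *: u.
  by rewrite opprB [mu + _]addrC subrK addrK.
(* Here mu - c_i is m_i / r_i^2, written in the form that [solve] expects for k = c_i. *)
have L1 : laplacian c.1 (local_map f1 c.1) (lsubmx x) =
    tension f1 c.1 (lsubmx x) - (mu - c1) *: local_map f1 c.1 (lsubmx x).
  by rewrite (tensionE imm1 ix1); exact: shift.
have L2 : laplacian c.2 (local_map f2 c.2) (rsubmx x) =
    tension f2 c.2 (rsubmx x) - (mu - c2) *: local_map f2 c.2 (rsubmx x).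
  by rewrite (tensionE imm2 ix2); exact: shift.
have solve d (l t u : 'rV[R]_d) k :
    l + k *: (t - (mu - k) *: u) - S *: u + mu *: (t + k *: u) = 0 ->
    l = (S - k ^+ 2) *: u - (mu + k) *: t.
  move=> E; apply/rowP => j; move/rowP/(_ j): E; rewrite !mxE => E.
  by lra.
rewrite L1 L2 -/mu -[0 in RHS](@row_mx0 _ 1 d1 d2) => /eq_row_mx[E1 E2].
by split; apply: solve.
Qed.

End ProductImmersion.
(** * Rigidity and reduction of the codimension *)

Section Rigidity.
Variables (R : realType) (m1 m2 d1 d2 : nat).
Variables (M1 : riemannian R m1) (M2 : riemannian R m2).
Variables (f1 : M1 -> 'rV[R]_d1) (f2 : M2 -> 'rV[R]_d2) (r1 r2 : R).
Variables (r1_gt0 : 0 < r1) (r2_gt0 : 0 < r2) (r12 : r1 ^+ 2 + r2 ^+ 2 = 1).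
Variables (imm1 : isometric_immersion f1 r1) (imm2 : isometric_immersion f2 r2).

Let f := prod_immersion f1 f2.
Let mu : R := (m1 + m2)%:R.

Lemma img_prod_pair (a : chart M1) (b : chart M2) x1 x2 :
  img a x1 -> img b x2 ->
  @img _ _ (prod_riemannian M1 M2) (a, b) (row_mx x1 x2).
Proof.
by move=> i1 i2; rewrite (@prod_img R m1 m2 M1 M2 (a, b)) /= row_mxKl row_mxKr.
Qed.

(* The first factor of the biharmonic equation, paired with [f1], expresses
   |tension f|^2 through the first variable alone. *)
Lemma tension_norm_constant :
  biharmonic f ->
  (exists (a : chart M1) x, img a x /\ tension f1 a x != 0) ->
  (exists (b : chart M2) y, img b y /\ tension f2 b y != 0) ->
  exists S s1 s2 : R,
  [/\ s1 != 0 /\ s2 != 0,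
      forall (c : chart (prod_riemannian M1 M2)) x, img c x ->
        dot (tension f c x) (tension f c x) = S,
      forall (a : chart M1) x, img a x -> dot (tension f1 a x) (tension f1 a x) = s1
    & forall (b : chart M2) y, img b y -> dot (tension f2 b y) (tension f2 b y) = s2].
Proof.
move=> bih [a0 [x0 [Ux0 Tx0]]] [b0 [y0 [Uy0 Ty0]]].
pose T1 (a : chart M1) x := dot (tension f1 a x) (tension f1 a x).
pose T2 (b : chart M2) y := dot (tension f2 b y) (tension f2 b y).
pose c1 := mu - m1%:R / r1 ^+ 2; pose c2 := mu - m2%:R / r2 ^+ 2.
pose K := c1 ^+ 2 * r1 ^+ 2 + c2 ^+ 2 * r2 ^+ 2.
have r1n : r1 ^+ 2 != 0 by rewrite expf_neq0 // gt_eqF.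
have r2n : r2 ^+ 2 != 0 by rewrite expf_neq0 // gt_eqF.
have norms (a : chart M1) (b : chart M2) x y : img a x -> img b y ->
    T1 a x = (T1 a x + T2 b y + K - c1 ^+ 2) * r1 ^+ 2 /\
    T2 b y = (T1 a x + T2 b y + K - c2 ^+ 2) * r2 ^+ 2.
  move=> Ux Uy; have Uc := img_prod_pair Ux Uy.
  have := biharmonic_components r12 imm1 imm2 bih Uc.
  rewrite /= (dot_tension_prod r1_gt0 r2_gt0 r12 imm1 imm2 Uc) /= row_mxKl row_mxKr.
  rewrite -/(T1 a x) -/(T2 b y) -/mu -/c1 -/c2 -/K => -[L1 L2].
  split.
  - rewrite {1}/T1 -(dot_laplacian_tension_map r1_gt0 imm1 Ux) L1.
    rewrite dotBl 2!dotZl (dot_map imm1) (dot_tension_map r1_gt0 imm1 Ux).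
    by rewrite mulr0 subr0.
  - rewrite {1}/T2 -(dot_laplacian_tension_map r2_gt0 imm2 Uy) L2.
    rewrite dotBl 2!dotZl (dot_map imm2) (dot_tension_map r2_gt0 imm2 Uy).
    by rewrite mulr0 subr0.
(* The equation t = (t + k) p determines t, since 1 - p = q is nonzero. It is used with p and q the
   two squared radii, which sum to 1. *)
have sep (t t' k p q : R) : p = 1 - q -> q != 0 ->
    t = (t + k) * p -> t' = (t' + k) * p -> t = t'.
  move=> -> q0; have E u : u = (u + k) * (1 - q) -> u * q = k * (1 - q).
    move=> h; apply/eqP; rewrite -subr_eq0.
    have -> : u * q - k * (1 - q) = u - (u + k) * (1 - q) by ring.
    by rewrite -h subrr.
  by move=> /E h /E h'; apply: (mulIf q0); rewrite h h'.
(* With the second point frozen at [y0], the constant [k] of [sep] does not depend on the first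
   point. *)
have T1E a x : img a x -> T1 a x = T1 a0 x0.
  move=> Ux; have [E _] := norms _ _ _ _ Ux Uy0.
  have [E0 _] := norms _ _ _ _ Ux0 Uy0.
  have comm (t : R) : t + (T2 b0 y0 + K - c1 ^+ 2) = t + T2 b0 y0 + K - c1 ^+ 2.
    by ring.
  have p : r1 ^+ 2 = 1 - r2 ^+ 2 by rewrite -r12 addrK.
  by rewrite -comm in E; rewrite -comm in E0; exact: sep p r2n E E0.
have T2E b y : img b y -> T2 b y = T2 b0 y0.
  move=> Uy; have [_ E] := norms _ _ _ _ Ux0 Uy.
  have [_ E0] := norms _ _ _ _ Ux0 Uy0.
  have comm (t : R) : t + (T1 a0 x0 + K - c2 ^+ 2) = T1 a0 x0 + t + K - c2 ^+ 2.
    by ring.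
  have p : r2 ^+ 2 = 1 - r1 ^+ 2 by rewrite -r12 addrAC subrr add0r.
  by rewrite -comm in E; rewrite -comm in E0; exact: sep p r1n E E0.
exists (T1 a0 x0 + T2 b0 y0 + K), (T1 a0 x0), (T2 b0 y0); split => //.
- by split; rewrite dot_eq0.
- move=> c x Ux; have [i1 i2] := img_prod Ux.
  rewrite (dot_tension_prod r1_gt0 r2_gt0 r12 imm1 imm2 Ux).
  by rewrite -/(T1 _ _) -/(T2 _ _) (T1E _ _ i1) (T2E _ _ i2).
Qed.

End Rigidity.
(** The map [psi], f followed by [Q^T], gives the coordinates of f - W in the span of the rows of
    [Q], and |f - W|^2 = 1 - 1 + 1/2. Multiplying lap f = 2 m (W - f) by [Q^T] kills [W], so lap psi
    = -(m / rho^2) psi, which is minimality in the sphere of radius [rho]. *)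
Lemma small_hypersphere_reduction (R : realType) (m d k : nat)
    (M : riemannian R m) (f : M -> 'rV[R]_d) (Q : 'M[R]_(k, d)) (W : 'rV[R]_d) :
  isometric_immersion f 1 ->
  Q *m Q^T = 1%:M -> W *m Q^T = 0 -> dot W W = 2^-1 ->
  (forall p, f p *m Q^T *m Q = f p - W) -> (forall p, dot (f p) W = 2^-1) ->
  (forall (a : chart M) x, img a x ->
     tension f a x + m%:R *: local_map f a x = (2 * m%:R) *: W) ->
  minimal_in_small_hypersphere k (1 / Num.sqrt 2) M f.
Proof.
move=> imm QQ WQ WW fQ fW fT.
set rho := 1 / Num.sqrt 2.
have rho_gt0 : 0 < rho by rewrite divr_gt0 // sqrtr_gt0.
have rho2 : rho ^+ 2 = 2^-1 by rewrite expr_div_n expr1n sqr_sqrtr // div1r.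
(* The height sqrt (1 - rho^2) of the small sphere is 1 / sqrt 2; times the last row sqrt 2 W of the
   matrix chosen below, it gives [W]. *)
have root : Num.sqrt (1 - rho ^+ 2) * Num.sqrt 2 = 1.
  rewrite rho2 -sqrtrM; last by lra.
  have -> : (1 - 2^-1) * 2 = 1 :> R by field.
  exact: sqrtr1.
pose psi p := f p *m Q^T.
have sF (a : chart M) := smooth_local_map imm a.
have smooth_psi (a : chart M) : smooth_on (img a) (local_map psi a).
  by move=> j; apply: (Ck_linl (mulmxr Q^T)); [exact: open_img|exact: sF].
have partialQ e (a : chart M) (B : 'M[R]_(d, e)) i x : img a x ->
    partial i (fun y => local_map f a y *m B) x = dmap f a i x *m B.
  move=> Ux; apply: (derive_linl (mulmxr B)).
  exact: smooth_differentiable (sF a) Ux.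
have dpsi (a : chart M) i x : img a x -> dmap psi a i x = dmap f a i x *m Q^T.
  by move=> Ux; exact: partialQ.
have dfQ (a : chart M) i x : img a x -> dmap f a i x *m Q^T *m Q = dmap f a i x.
  move=> Ux; rewrite -mulmxA -(partialQ _ _ _ _ _ Ux).
  have E y : img a y -> local_map f a y *m (Q^T *m Q) = local_map f a y + -1 *: W.
    by move=> _; rewrite mulmxA scaleN1r; exact: fQ.
  rewrite (eq_partial i Ux E) (partialD i Ux (sF a)); last exact: smooth_cst.
  by rewrite [X in _ + X]derive_cst addr0 partial_local_map.
have gram (a : chart M) x : img a x ->
    forall i j, dot (dmap psi a i x) (dmap psi a j x) = metric a x i j.
  move=> Ux i j; rewrite !dpsi // dot_mulmxl trmxK dfQ //.
  exact: (dot_dmap imm i j Ux).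
have imm_psi : isometric_immersion psi rho.
  split=> [p|a]; last first.
    split=> // x Ux; split; last exact: gram.
    exact: row_free_gram (smooth_psi a) Ux (gram a x Ux).
  have E : dot (psi p) (psi p) = rho ^+ 2.
    have [/(_ p)/= /(congr1 (fun t => t ^+ 2)) + _] := imm.
    rewrite enorm_sqr expr1n => ff.
    by rewrite /psi dot_mulmxl trmxK fQ dotBr ff fW rho2; field.
  by rewrite /sphere /= /enorm E sqrtr_sqr ger0_norm // ltW.
(* The last row is a unit vector because |W|^2 = 1/2, and it completes [Q] to k + 1 orthonormal
   rows. *)
exists (col_mx Q (Num.sqrt 2 *: W)), psi; split=> //.
- rewrite tr_col_mx mul_col_row QQ linearZ /= -scalemxAl -!scalemxAr -scalemxAl.
  rewrite WQ mulmx_tr WW -[Q *m W^T]trmxK trmx_mul trmxK WQ trmx0 !scaler0.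
  rewrite scalerA -expr2 sqr_sqrtr // scale_scalar_mx mulfV ?pnatr_eq0 //.
  by rewrite -scalar_mx_block.
- move=> a x Ux; rewrite mean_curvatureE (tensionE imm_psi Ux).
  rewrite (laplacian_mulmxr Q^T Ux (sF a)).
  have -> : laplacian a (local_map f a) x =
      (2 * m%:R) *: W - (2 * m%:R) *: local_map f a x.
    rewrite -(fT a x Ux) (tensionE imm Ux) expr1n divr1.
    have E (l u : 'rV[R]_d) (t : R) : l = l + t *: u + t *: u - (2 * t) *: u.
      by apply/rowP => j; rewrite !mxE; ring.
    exact: E.
  rewrite mulmxBl -!scalemxAl WQ scaler0 sub0r rho2 invrK [m%:R * 2]mulrC.
  by rewrite addNr scaler0.
- move=> p; rewrite /small_hypersphere_incl mul_row_col mul_scalar_mx scalerA.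
  by rewrite root scale1r /psi fQ subrK.
Qed.
(** The constant vector v = tau + k f satisfies <f, v> = k r^2 and |v|^2 = s + k^2 r^2 = 2 mu k r^2.
    Dividing by 2 mu makes <f, w> = |w|^2: [w] is the foot of the perpendicular from the origin to
    an affine hyperplane containing the image. *)
Lemma factor_hyperplane (R : realType) (m d : nat) (M : riemannian R m)
    (f : M -> 'rV[R]_d) (r mu s : R) (k := mu + (mu - m%:R / r ^+ 2)) :
  0 < r -> isometric_immersion f r -> (0 < m)%N -> mu != 0 -> s != 0 -> M ->
  s = m%:R * k ->
  (forall (a : chart M) x, img a x -> dot (tension f a x) (tension f a x) = s) ->
  (forall (a : chart M) x, img a x ->
    forall i, partial i (tension f a) x = - k *: dmap f a i x) ->
  exists w, [/\ w != 0, dot w w = k * r ^+ 2 / (2 * mu),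
    forall p, dot (f p) w = k * r ^+ 2 / (2 * mu)
  & forall (a : chart M) x, img a x ->
    tension f a x + k *: local_map f a x = (2 * mu) *: w].
Proof.
move=> r0 imm m_gt0 mu0 s0 p0 sk sE dT.
have [v vE] := tension_shift_constant p0 r0 imm dT.
have rn0 : r != 0 by rewrite gt_eqF.
have k0 : k != 0 by apply: contra_neq s0 => k0; rewrite sk k0 mulr0.
have mu20 : 2 * mu != 0 by rewrite mulf_neq0 // pnatr_eq0.
have fv p : dot (f p) v = k * r ^+ 2.
  have [a ap] := dom_cover p; have Ux := img_chart ap.
  rewrite -(vE a _ Ux) -{1}(chart_mapK ap) -/(local_map f a (chart_map a p)).
  rewrite dotDr dotZr (dot_map imm) dotC (dot_tension_map r0 imm Ux).
  by rewrite add0r.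
have vv : dot v v = s + k ^+ 2 * r ^+ 2.
  have [a ap] := dom_cover p0; have Ux := img_chart ap.
  rewrite -{1}(vE a _ Ux) dotDl dotZl -[X in dot (tension _ _ _) X](vE a _ Ux).
  rewrite dotDr dotZr (dot_tension_map r0 imm Ux) mulr0 addr0 sE //.
  rewrite -[local_map f a _]/(f (param a (chart_map a p0))) fv.
  by ring.
have ww : dot ((2 * mu)^-1 *: v) ((2 * mu)^-1 *: v) = k * r ^+ 2 / (2 * mu).
  rewrite dotZl dotZr vv sk.
  (* By definition of [k], m + k r^2 = 2 mu r^2. *)
  have -> : m%:R * k + k ^+ 2 * r ^+ 2 = k * r ^+ 2 * (2 * mu).
    by rewrite /k; field.
  by field.
exists ((2 * mu)^-1 *: v); split=> //.
- rewrite -dot_eq0 ww mulf_neq0 ?invr_eq0 //.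
  by rewrite mulf_neq0 // expf_neq0.
- by move=> p; rewrite dotZr fv mulrC.
- by move=> a x Ux; rewrite scalerA mulfV // scale1r vE.
Qed.

(* The sphere S^ni(ri) lies in R^(ni + 1), S^n in
   R^(n + 1) = R^((n1 + 1) + (n2 + 1)), and S^(n - 2)(1 / sqrt 2) in R^(n - 1). *)
Theorem theorem4p4 (R : realType) (m1 m2 n1 n2 n : nat) (r1 r2 : R)
  (M1 : riemannian R m1) (M2 : riemannian R m2)
  (phi1 : M1 -> 'rV[R]_(n1.+1)) (phi2 : M2 -> 'rV[R]_(n2.+1))
  (hr1 : 0 < r1) (hr2 : 0 < r2) (hr : r1 ^+ 2 + r2 ^+ 2 = 1)
  (hn : (n1 + n2)%N.+1 = n)
  (himm1 : isometric_immersion phi1 r1)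
  (himm2 : isometric_immersion phi2 r2)
  (hnm1 : ~ minimal phi1) (hnm2 : ~ minimal phi2)
  (hbih : proper_biharmonic (prod_immersion phi1 phi2)) :
  (unit_mean_curvature (prod_immersion phi1 phi2) <->
     (pmc phi1 /\ pseudo_umbilical phi1) /\
     (pmc phi2 /\ pseudo_umbilical phi2)) /\
  (unit_mean_curvature (prod_immersion phi1 phi2) ->
     minimal_in_small_hypersphere n.-1 (1 / Num.sqrt 2)
       (prod_riemannian M1 M2) (prod_immersion phi1 phi2)).
Proof.
have m1_gt0 := nonminimal_gt0 hnm1; have m2_gt0 := nonminimal_gt0 hnm2.
have T1 := nonminimal_point hnm1; have T2 := nonminimal_point hnm2.
have [bih _] := hbih.
have [S [s1 [s2 [[s10 s20] SE s1E s2E]]]] :=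
  tension_norm_constant hr1 hr2 hr himm1 himm2 bih T1 T2.
have [a0 [x0 [Ux0 _]]] := T1; have [b0 [y0 [Uy0 _]]] := T2.
pose mu : R := (m1 + m2)%:R.
have mu0 : mu != 0 by rewrite pnatr_eq0 -lt0n addn_gt0 m1_gt0.
have L (a : chart M1) (b : chart M2) x y : img a x -> img b y ->
    laplacian a (tension phi1 a) x =
      (S - (mu - m1%:R / r1 ^+ 2) ^+ 2) *: local_map phi1 a x
      - (mu + (mu - m1%:R / r1 ^+ 2)) *: tension phi1 a x /\
    laplacian b (tension phi2 b) y =
      (S - (mu - m2%:R / r2 ^+ 2) ^+ 2) *: local_map phi2 b y
      - (mu + (mu - m2%:R / r2 ^+ 2)) *: tension phi2 b y.
  move=> Ux Uy; have Uc := img_prod_pair Ux Uy.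
  have := biharmonic_components hr himm1 himm2 bih Uc.
  by rewrite /= (SE _ _ Uc) row_mxKl row_mxKr.
have [rig1 hyp1] := factor_rigidity hr1 himm1 m1_gt0 s10
  (ex_intro _ a0 (ex_intro _ x0 Ux0)) s1E (fun a x Ux => (L a b0 x y0 Ux Uy0).1).
have [rig2 hyp2] := factor_rigidity hr2 himm2 m2_gt0 s20
  (ex_intro _ b0 (ex_intro _ y0 Uy0)) s2E (fun b y Uy => (L a0 b x0 y Ux0 Uy).2).
have unitE : unit_mean_curvature (prod_immersion phi1 phi2) <-> S = mu ^+ 2.
  have H (c : chart (prod_riemannian M1 M2)) x : img c x ->
      enorm (mean_curvature (prod_immersion phi1 phi2) c x) ^+ 2 = S / mu ^+ 2.
    move=> Ux; rewrite enorm_sqr mean_curvatureE -/mu (dotZl mu^-1) (dotZr mu^-1).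
    by rewrite (SE c x Ux) mulrA -invfM mulrC -expr2.
  split=> [h|h c x Ux].
    have Uc := img_prod_pair Ux0 Uy0.
    have := H _ _ Uc; rewrite h // expr1n => /esym /(canRL (divfK _)) -> //.
      by rewrite mul1r.
    by rewrite expf_neq0.
  have := H _ _ Ux; rewrite h divff ?expf_neq0 // => /eqP.
  by rewrite sqrp_eq1 ?sqrtr_ge0 // => /eqP.
split; first by rewrite unitE; split=> [h|[/rig1]//]; split; [exact/rig1|exact/rig2].
move=> /unitE Smu.
have [sk1 dT1] := hyp1 Smu; have [sk2 dT2] := hyp2 Smu.
have [w1 [w10 ww1 fw1 vw1]] := factor_hyperplane hr1 himm1 m1_gt0 mu0 s10
  (param a0 x0) sk1 s1E dT1.
have [w2 [w20 ww2 fw2 vw2]] := factor_hyperplane hr2 himm2 m2_gt0 mu0 s20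
  (param b0 y0) sk2 s2E dT2.
(* Each factor loses one dimension, the direction of its w_i; together they lower the ambient
   dimension n + 1 to n - 1. *)
have [Q1 [QQ1 wQ1 pQ1]] := hyperplane_basis w10.
have [Q2 [QQ2 wQ2 pQ2]] := hyperplane_basis w20.
(* This is |W|^2 for W = (w1, w2): the radii contribute 1 and the dimensions subtract (m1 + m2) / (2
   mu) = 1/2. *)
have half : (mu + (mu - m1%:R / r1 ^+ 2)) * r1 ^+ 2 / (2 * mu) +
    (mu + (mu - m2%:R / r2 ^+ 2)) * r2 ^+ 2 / (2 * mu) = 2^-1.
  have E (t u v : R) : t != 0 ->
      (t + (t - u / r1 ^+ 2)) * r1 ^+ 2 / (2 * t) +
      (t + (t - v / r2 ^+ 2)) * r2 ^+ 2 / (2 * t) =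
      r1 ^+ 2 + r2 ^+ 2 - (u + v) / (2 * t).
    by move=> t0; field; rewrite t0 !gt_eqF.
  by rewrite (E mu) // hr -natrD -/mu invfM mulrCA divff // mulr1; field.
(* Each difference f_i - w_i is orthogonal to w_i, hence lies in the row space of Q_i. *)
have fQ p : prod_immersion phi1 phi2 p *m (block_mx Q1 0 0 Q2)^T *m block_mx Q1 0 0 Q2
    = prod_immersion phi1 phi2 p - row_mx w1 w2.
  case: p => p q; rewrite /prod_immersion /= tr_block_mx !trmx0.
  rewrite !mul_row_block !mulmx0 !addr0 !add0r opp_row_mx add_row_mx.
  have proj n' (w u : 'rV[R]_n'.+1) (Q : 'M[R]_(n', n'.+1)) :
      dot u w = dot w w -> w *m Q^T = 0 ->
      (forall u, dot u w = 0 -> u *m Q^T *m Q = u) -> u *m Q^T *m Q = u - w.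
    move=> uw wQ pQ; rewrite -[RHS]pQ; last by rewrite dotBl uw subrr.
    by rewrite mulmxBl wQ subr0.
  by congr row_mx; apply: proj; rewrite // ?fw1 ?fw2 ?ww1 ?ww2.
(* Now [n.-1] is n1 + n2, the number of rows of the block matrix, while the ambient space has
   dimension n1.+1 + n2.+1. *)
subst n; rewrite /=.
apply: (small_hypersphere_reduction (Q := block_mx Q1 0 0 Q2) (W := row_mx w1 w2)).
- exact: (prod_isometric hr himm1 himm2).
- rewrite tr_block_mx !trmx0 mulmx_block !mulmx0 !mul0mx !addr0 !add0r QQ1 QQ2.
  by rewrite -scalar_mx_block.
- by rewrite tr_block_mx !trmx0 mul_row_block !mulmx0 addr0 add0r wQ1 wQ2 row_mx0.
- by rewrite dot_row_mx ww1 ww2.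
- exact: fQ.
- by case=> p q; rewrite /prod_immersion dot_row_mx fw1 fw2.
- move=> c x Ux; have [i1 i2] := img_prod Ux.
  rewrite (tension_prod hr himm1 himm2 Ux) local_map_prod.
  rewrite scale_row_mx add_row_mx scale_row_mx -/mu.
  rewrite -(vw1 _ _ i1) -(vw2 _ _ i2).
  (* Applied with k = c_i, this turns (tau_i + c_i f_i) + mu f_i into the vector that equals 2 mu
     w_i. *)
  have E d (t u : 'rV[R]_d) k : t + k *: u + mu *: u = t + (mu + k) *: u.
    by rewrite -addrA -scalerDl [k + _]addrC.
  by rewrite !E.
Qed.
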